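(* Let $f$ be a smooth real-valued function on a neighbourhood of the origin in $\mathbb{R}^n$ with $f(0)=0$ and $\nabla f(0)=0$. Assume that $f$ is non-negative, non-degenerate and satisfies the KN-condition. Then $$\alpha(f)=d(f).$$
   Context: Smooth means $C^\infty$; $\|\cdot\|$ is the Euclidean norm; $\mathbb{Z}_+$, $\mathbb{R}_+$ denote the nonnegative integers and reals. Newton polyhedron: if $\sum_\alpha c_\alpha \mathbf{x}^\alpha$ is the Taylor series of $f$ at $0$, then $\Gamma_+(f)$ is the convex hull of $\bigcup\{\alpha+\mathbb{R}^n_+ : c_\alpha\neq 0\}$; it is assumed non-empty. $V_{\Gamma_+(f)}$ is the set of its vertices. A pair $(\mathbf{a},l)\in\mathbb{R}^n\times\mathbb{R}$ is valid if $\langle\mathbf{a},\mathbf{x}\rangle\ge l$ for all $\mathbf{x}\in\Gamma_+(f)$; then $\gamma=\{\mathbf{x}\in\Gamma_+(f):\langle\mathbf{a},\mathbf{x}\rangle=l\}$ is the face of $\Gamma_+(f)$ defined by $(\mathbf{a},l)$. KN-condition: for every face $\gamma$ of $\Gamma_+(f)$ and every valid pair $(\mathbf{a},l)$ defining $\gamma$, with $\mathbf{a}=(a_1,\dots,a_n)$, the limit $\lim_{t\to 0^+} f(t^{a_1}x_1,\dots,t^{a_n}x_n)/t^l$ exists for all $\mathbf{x}$ in a neighbourhood of the origin. Non-degeneracy: for a compact face $\gamma$ put $f_\gamma(\mathbf{x})=\sum_{\alpha\in\gamma\cap\mathbb{Z}^n_+}c_\alpha\mathbf{x}^\alpha$.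 $f$ is non-degenerate if for every compact face $\gamma$ of $\Gamma_+(f)$ the system $\partial f_\gamma/\partial x_j(\mathbf{x})=0$, $j=1,\dots,n$, has no solutions in $(\mathbb{R}\setminus\{0\})^n$. $\alpha(f)$ is the infimum of all $\alpha>0$ with the following property: for every smooth function $g$ near the origin such that $f^{-1}(0)\subset g^{-1}(0)$ in a neighbourhood of the origin, there exist $c,\varepsilon>0$ such that $|f(\mathbf{x})|\ge c|g(\mathbf{x})|^{\alpha}$ for all $\|\mathbf{x}\|<\varepsilon$. $d(f)$: for $\alpha=(\alpha_1,\dots,\alpha_n)\in\mathbb{Z}_+^n$ put $I(\alpha)=\{i:\alpha_i\neq0\}$ and $\hat\alpha=(\hat\alpha_1,\dots,\hat\alpha_n)$ with $\hat\alpha_i=1$ if $i\in I(\alpha)$ and $\hat\alpha_i=0$ otherwise. Let $\hat\Gamma_+(f)$ be the convex hull of $\bigcup_{\alpha\in V_{\Gamma_+(f)}}\{\hat\alpha+\mathbb{R}^n_+\}$ and $V_{\hat\Gamma_+(f)}$ the set of its vertices (which are $0/1$ vectors). For $\alpha^*\in V_{\hat\Gamma_+(f)}$ let $\Delta(\alpha^* )=\{t\alpha^*: t\in\mathbb{R}\}$ and let $D(\alpha^* )=d(\alpha^* )\alpha^*$ be the point where the line $\Delta(\alpha^* )$, traversed from the origin in the direction of $\alpha^*$, first meets $\Gamma_+(f)$, i.e. $d(\alpha^* )=\min\{t>0: t\alpha^*\in\Gamma_+(f)\}$. Finally $d(f)=\max\{d(\alpha^* ):\alpha^*\in V_{\hat\Gamma_+(f)}\}$.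 *)

(* Defs.v *)
From mathcomp Require Import all_boot all_order all_algebra.
From mathcomp Require Import all_classical all_reals all_analysis.
Set Implicit Arguments.
Unset Strict Implicit.
Unset Printing Implicit Defensive.
Import Order.TTheory GRing.Theory Num.Theory.
Import numFieldNormedType.Exports.
Local Open Scope classical_set_scope.
Local Open Scope ring_scope.

(* Points of R^n are row vectors 'rV[R]_n and multi-indices are finite
   functions {ffun 'I_n -> nat}. A function defined near the origin is encoded
   as a total function; every notion below that concerns the behaviour at the
   origin depends only on its germ there. *)

Section Calculus.
Context {R : realType} {n : nat}.
Implicit Types (f : 'rV[R]_n -> R) (a : {ffun 'I_n -> nat}) (x : 'rV[R]_n).

Definition partial (i : 'I_n) f : 'rV[R]_n -> R :=
  fun x => 'D_(delta_mx 0 i) f x.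

Definition iter_partial (s : seq 'I_n) f : 'rV[R]_n -> R := foldr partial f s.

(* C^oo on U (meant for open U): the partial derivatives of all orders, taken
   in any order of the variables, exist and are continuous at the points of U.
   The existence clause is needed because 'D_v is total. *)
Definition smooth_on (U : set 'rV[R]_n) f : Prop :=
  forall (s : seq 'I_n) x, U x ->
    {for x, continuous (iter_partial s f)} /\
    forall i : 'I_n, derivable (iter_partial s f) x (delta_mx 0 i).

Definition smooth_near0 f : Prop :=
  exists U : set 'rV[R]_n, [/\ open U, U 0 & smooth_on U f].

Definition monomial a x : R := \prod_i x 0 i ^+ a i.

Definition deriv_multi a f : 'rV[R]_n -> R :=
  iter_partial (flatten [seq nseq (a i) i | i <- enum 'I_n]) f.

Definition taylor_coeff f a : R :=
  deriv_multi a f 0 / (\prod_i (a i)`!)%N%:R.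

(* The library norm on 'rV[R]_n is the sup norm. *)
Definition enorm x : R := Num.sqrt (\sum_i x 0 i ^+ 2).

End Calculus.

Section Extrema.
Context {R : realType}.

(* Junk value when the extremum does not exist. *)
Definition minimum (A : set R) : R := get (A `&` lbound A).
Definition maximum (A : set R) : R := get (A `&` ubound A).

End Extrema.

Section Polyhedra.
Context {R : realType} {n : nat}.
Implicit Types (P A F : set 'rV[R]_n) (a x v : 'rV[R]_n) (l : R).

Definition convex_hull A : set 'rV[R]_n :=
  smallest (fun C => convex_set (C : set (convex_lmodType 'rV[R]_n))) A.

Definition orthant_at v : set 'rV[R]_n :=
  [set v + r | r in [set r : 'rV[R]_n | forall i, 0 <= r 0 i]].

Definition dot a x : R := \sum_i a 0 i * x 0 i.

Definition valid_pair P a l : Prop := forall x, P x -> l <= dot a x.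

Definition face_of P a l : set 'rV[R]_n := [set x | P x /\ dot a x = l].

(* Faces are nonempty: the pairs with l strictly below the minimum of dot a
   on P are valid but define no face. *)
Definition defines_face P a l F : Prop :=
  [/\ valid_pair P a l, F = face_of P a l & F !=set0].

Definition is_face P F : Prop := exists a l, defines_face P a l F.

Definition vertices P : set 'rV[R]_n := [set v | is_face P [set v]].

End Polyhedra.

Section Newton.
Context {R : realType} {n : nat}.
Implicit Types (f g : 'rV[R]_n -> R) (F : set 'rV[R]_n) (x : 'rV[R]_n).
Implicit Types (a : {ffun 'I_n -> nat}).

Definition int_point a : 'rV[R]_n := \row_i (a i)%:R.

Definition newton_polyhedron f : set 'rV[R]_n :=
  convex_hull (\bigcup_(a in [set a | taylor_coeff f a != 0])
                 orthant_at (int_point a)).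

Definition weighted_scale (w : 'rV[R]_n) (t : R) x : 'rV[R]_n :=
  \row_i (t `^ w 0 i * x 0 i).

Definition KN_condition f : Prop :=
  forall F (w : 'rV[R]_n) (l : R),
    defines_face (newton_polyhedron f) w l F ->
    \forall x \near (0 : 'rV[R]_n),
      cvg ((f (weighted_scale w t x) / t `^ l) @[t --> 0^'+]).

(* The sum ranges over the multi-indices in F; it is finite, hence not the
   default value of \sum_(_ \in _), when F is compact. *)
Definition face_part f F : 'rV[R]_n -> R :=
  fun x => \sum_(a \in [set a | F (int_point a)])
             (taylor_coeff f a * monomial a x).

Definition newton_nondegenerate f : Prop :=
  forall F, is_face (newton_polyhedron f) F -> compact F ->
    ~ exists x, (forall j, x 0 j != 0) /\
                (forall j, partial j (face_part f F) x = 0).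

Definition lojasiewicz_property f (alpha : R) : Prop :=
  forall g, smooth_near0 g ->
    (\forall x \near (0 : 'rV[R]_n), f x = 0 -> g x = 0) ->
    exists c eps : R, [/\ 0 < c, 0 < eps &
      forall x, enorm x < eps -> c * `|g x| `^ alpha <= `|f x|].

(* alpha(f); equal to +oo if no exponent is admissible. *)
Definition lojasiewicz_exponent f : \bar R :=
  ereal_inf [set alpha%:E | alpha in
    [set alpha : R | 0 < alpha /\ lojasiewicz_property f alpha]].

Definition hat a : 'rV[R]_n := \row_i (a i != 0%N)%:R.

(* The vertices of the Newton polyhedron are integer points, so ranging over
   the multi-indices a such that int_point a is a vertex misses none. *)
Definition hat_polyhedron f : set 'rV[R]_n :=
  convex_hull (\bigcup_(a in [set a | vertices (newton_polyhedron f)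
                                               (int_point a)])
                 orthant_at (hat a)).

Definition ray_distance f (v : 'rV[R]_n) : R :=
  minimum [set t : R | 0 < t /\ newton_polyhedron f (t *: v)].

(* d(f) *)
Definition newton_distance f : R :=
  maximum [set ray_distance f v | v in vertices (hat_polyhedron f)].

End Newton.

(* Main.v *)
Require Import Defs.
From mathcomp Require Import all_boot all_order all_algebra.
From mathcomp Require Import all_classical all_reals all_analysis.
From mathcomp Require Import ring lra zify.
Import Order.TTheory GRing.Theory Num.Theory.
Import numFieldNormedType.Exports.
Set Implicit Arguments.
Unset Strict Implicit.
Unset Printing Implicit Defensive.
Local Open Scope classical_set_scope.
Local Open Scope ring_scope.

(** Up to constants, [f] is near the origin as large as the sum of the [|x^v|],
    [v] a vertex of its Newton polyhedron (lemmas [newton_lower_bound] and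
    [newton_expansion]). The exponent is then read off from this monomial model.

    To compare [f] with the model, expand [f] by Taylor's formula in each variable
    separately, up to an order [N] beyond all vertices. This writes [f] as a finite
    sum of parts, each bounded by a monomial [|x^q|] with [q i <= N], where
    [q i = N] stands for a remainder in the variable [i]. If [q] lies off the
    polyhedron, the KN-condition along a generic weighted curve forces the part to
    vanish identically ([KN_taylor_part_vanish]); only exponents of the polyhedron
    remain, and those on a compact face carry genuine Taylor coefficients.

    For the lower bound, suppose that [f] is much smaller than the model along an
    ultrafilter converging to [0]. The logarithmic coordinates [- ln |x_i|] split
    into a bounded vector and a weight vector in the normal cone of one compact
    face; all parts off this face become negligible, and [f] is governed by the
    face part at a point of a compact subset of the torus. The face part is
    nonnegative because [f] is, and it has no zero in the torus: such a zero would
    be a minimum, hence critical, against non-degeneracy ([face_poly_gt0]).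

    The zero set of [f] is therefore a union of coordinate subspaces. A smooth [g]
    vanishing on it is bounded by the sum of the squarefree monomials
    [|x^(hat v)|] (Hadamard's lemma, [vanishing_bound]). Since [d(f) * hat v] lies
    in the polyhedron for every vertex [v], the power [|x^(hat v)|^d(f)] is bounded
    by the model, so that [d(f)] is admissible ([lojasiewicz_upper]). Conversely,
    testing an admissible [alpha] on [g = x^(hat v)] along weighted curves puts
    [alpha * hat v] into the polyhedron, whence [d(f) <= alpha]
    ([lojasiewicz_lower]). *)

(** * Separation of a point from a finitely generated polyhedron *)

Section Dot.
Context {R : realType} {n : nat}.
Implicit Types (x y w : 'rV[R]_n).

Lemma dotC w x : dot w x = dot x w.
Proof. by apply: eq_bigr => i _; rewrite mulrC. Qed.

Lemma dotDr w x y : dot w (x + y) = dot w x + dot w y.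
Proof. by rewrite /dot -big_split; apply: eq_bigr => i _; rewrite mxE mulrDr. Qed.

Lemma dotDl w x y : dot (x + y) w = dot x w + dot y w.
Proof. by rewrite dotC dotDr !(dotC w). Qed.

Lemma dotZr w k x : dot w (k *: x) = k * dot w x.
Proof. by rewrite /dot mulr_sumr; apply: eq_bigr => i _; rewrite mxE mulrCA. Qed.

Lemma dotZl w k x : dot (k *: x) w = k * dot x w.
Proof. by rewrite dotC dotZr dotC. Qed.

Lemma dotNr w x : dot w (- x) = - dot w x.
Proof. by rewrite -scaleN1r dotZr mulN1r. Qed.

Lemma dotBr w x y : dot w (x - y) = dot w x - dot w y.
Proof. by rewrite dotDr dotNr. Qed.

Lemma dotBl w x y : dot (x - y) w = dot x w - dot y w.
Proof. by rewrite dotC dotBr !(dotC w). Qed.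

Lemma dot0r w : dot w 0 = 0.
Proof. by rewrite /dot big1 // => i _; rewrite mxE mulr0. Qed.

Lemma dot_sumr (I : Type) (r : seq I) (P : pred I) (F : I -> 'rV[R]_n) w :
  dot w (\sum_(i <- r | P i) F i) = \sum_(i <- r | P i) dot w (F i).
Proof. exact: (big_morph (dot w) (dotDr w) (dot0r w)). Qed.

Lemma dot_ge0 w x : (forall i, 0 <= w 0 i) -> (forall i, 0 <= x 0 i) ->
  0 <= dot w x.
Proof. by move=> w0 x0; apply: sumr_ge0 => i _; apply: mulr_ge0. Qed.

Lemma dot_le w x y : (forall i, 0 <= w 0 i) -> (forall i, x 0 i <= y 0 i) ->
  dot w x <= dot w y.
Proof. by move=> w0 xy; apply: ler_sum => i _; apply: ler_wpM2l. Qed.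

Lemma dotxx_gt0 x : x != 0 -> 0 < dot x x.
Proof.
move=> x0; rewrite lt_def; apply/andP; split; last first.
  by apply: sumr_ge0 => i _; rewrite -expr2 sqr_ge0.
apply: contra x0; rewrite psumr_eq0 => [/allP h|i _]; last by rewrite -expr2 sqr_ge0.
apply/eqP/rowP => i; rewrite mxE; apply/eqP.
by have := h i (mem_index_enum _); rewrite /= -expr2 sqrf_eq0.
Qed.

Lemma dot_delta w i : dot w (delta_mx 0 i) = w 0 i.
Proof.
rewrite /dot (bigD1 i) //= mxE !eqxx mulr1 big1 ?addr0 // => j ji.
by rewrite mxE (negPf ji) andbF mulr0.
Qed.

Lemma dot_continuous w : continuous (dot w).
Proof.
rewrite /dot; elim: (index_enum _) => [|i s IH] x.
  under eq_fun do rewrite big_nil.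
  exact: (@cst_continuous 'rV[R]_n R 0 x).
under eq_fun do rewrite big_cons.
apply: (@continuousD R R^o _ (fun y : 'rV[R]_n => w 0 i * y 0 i)); last exact: IH.
apply: (@continuousM R _ (fun=> w 0 i) (fun y : 'rV[R]_n => y 0 i)).
  exact: cst_continuous.
exact: coord_continuous.
Qed.

End Dot.

Lemma small_perturbation (R : realType) (T : finType) (P : pred T) (c d : T -> R) :
  (forall t, P t -> 0 < c t) ->
  \forall e \near (0 : R)^'+, forall t, P t -> 0 < c t + e * d t.
Proof.
move=> c0; apply: filter_forall => t; case Pt: (P t); last exact: nearW.
have ct := c0 t Pt; have dp : 0 < `|d t| + 1 by rewrite ltr_wpDl.
near=> e => _.
have e0 : 0 < e by near: e; exact: nbhs_right_gt.
have : e < c t / (`|d t| + 1) by near: e; apply: nbhs_right_lt; rewrite divr_gt0.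
rewrite ltr_pdivlMr // mulrDr mulr1 => h.
have : - (e * `|d t|) <= e * d t.
  by rewrite -mulrN ler_pM2l // lerNl -normrN ler_norm.
lra.
Unshelve. all: by end_near. Qed.

Section Polyhedron.
Context {R : realType} {n : nat}.
Implicit Types (x y w : 'rV[R]_n).

(** Gordan's alternative. Projecting along one of the vectors [b t0] removes it
    from the family; a weight found for the projected vectors is corrected by a
    small multiple of [b t0], and a vanishing combination of them says that a
    positive combination of the others is a multiple of [b t0], whose sign
    decides how to conclude. *)
Lemma gordan (T : finType) (b : T -> 'rV[R]_n) (D : {set T}) :
  (exists w, forall t, t \in D -> 0 < dot w (b t)) \/
  exists lam : T -> R, [/\ forall t, 0 <= lam t, forall t, t \notin D -> lam t = 0,
    exists t, 0 < lam t & \sum_t lam t *: b t = 0].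
Proof.
move: {2}#|D| (erefl #|D|) => k; elim: k D b => [|k IH] D b cD.
  by left; exists 0 => t; rewrite (cards0_eq cD) inE.
have [t0 t0D] : exists t, t \in D by apply/card_gt0P; rewrite cD.
have cD' : #|D :\ t0| = k by apply/eqP; rewrite -eqSS -cD (cardsD1 t0 D) t0D.
have [b00|b0n] := eqVneq (b t0) 0.
  right; exists (fun t => (t == t0)%:R); split.
  - by move=> t; rewrite ler0n.
  - by move=> t; case: eqP => // ->; rewrite t0D.
  - by exists t0; rewrite eqxx ltr01.
  - rewrite (bigD1 t0) //= eqxx b00 scaler0 add0r big1 // => t /negPf->.
    by rewrite scale0r.
have q0 := dotxx_gt0 b0n; set q := dot (b t0) (b t0) in q0.
pose b' t := b t - (dot (b t0) (b t) / q) *: b t0.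
have [[w Hw]|[lam [l0 lD [t1 lp] lb]]] := IH (D :\ t0) b' cD'.
  left; pose w' := w - (dot (b t0) w / q) *: b t0.
  have w'0 : dot w' (b t0) = 0.
    by rewrite /w' dotBl dotZl -/q mulfVK ?gt_eqF // dotC subrr.
  have w'b t : dot w' (b t) = dot w (b' t).
    rewrite /w' /b' dotBl dotBr dotZl dotZr (dotC w (b t0)).
    by congr (_ - _); rewrite -!mulrA; ring.
  have := @small_perturbation R T (mem (D :\ t0)) (fun t => dot w' (b t))
    (fun t => dot (b t0) (b t)) _.
  case=> [t tD|]; first by rewrite w'b; apply: Hw.
  move=> e e0 /= He; pose e' := e / 2.
  have e'0 : 0 < e' by rewrite divr_gt0.
  exists (w' + e' *: b t0) => t tD; rewrite dotDl dotZl.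
  have [->|tt0] := eqVneq t t0; first by rewrite w'0 add0r mulr_gt0.
  apply: (He e' _ e'0); last by rewrite !inE tt0.
  by rewrite /= sub0r normrN gtr0_norm // /e' ltr_pdivrMr // ltr_pMr // ltr1n.
pose kap := \sum_t lam t * (dot (b t0) (b t) / q).
have lbk : \sum_t lam t *: b t = kap *: b t0.
  apply: subr0_eq; rewrite -[RHS]lb /kap scaler_suml -sumrB.
  by apply: eq_bigr => t _; rewrite /b' scalerBr scalerA.
have lt0 : lam t0 = 0 by apply: lD; rewrite !inE eqxx.
have lD' t : t \notin D -> lam t = 0 by move=> tD; apply: lD; rewrite !inE (negPf tD) andbF.
have [kap0|kap0] := leP kap 0.
  right; exists (fun t => if t == t0 then - kap else lam t); split.
  - by move=> t; case: eqP => _ //; rewrite oppr_ge0.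
  - by move=> t tD; case: eqP tD => [->|_ tD]; [rewrite t0D|exact: lD'].
  - by exists t1; case: eqP lp => // ->; rewrite lt0 ltxx.
  - rewrite (bigD1 t0) //= eqxx scaleNr addrC -lbk [X in _ - X](bigD1 t0) //=.
    rewrite lt0 scale0r add0r; apply/eqP; rewrite subr_eq0; apply/eqP.
    by apply: eq_bigr => t /negPf->.
have [[w Hw]|[mu [m0 mD mp mb]]] := IH (D :\ t0) b cD'; last first.
  by right; exists mu; split=> // t tD; apply: mD; rewrite !inE (negPf tD) andbF.
left; exists w => t tD; have [->|tt0] := eqVneq t t0; last by apply: Hw; rewrite !inE tt0.
rewrite -(pmulr_rgt0 _ kap0) -dotZr -lbk dot_sumr (bigD1 t1) //= ltr_pwDl //.
  rewrite dotZr mulr_gt0 //; apply: Hw; apply: contraT => t1D.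
  by rewrite lD ?ltxx in lp.
apply: sumr_ge0 => s _; rewrite dotZr.
have [sD|sD] := boolP (s \in D :\ t0); last by rewrite lD // mul0r.
by rewrite mulr_ge0 // ltW // Hw.
Qed.

(** The convex hull of the orthants at the points [a t], [t \in D], described by
    explicit coefficients: a finite index type lets the Newton polyhedron and the
    polyhedron of its 0/1 vectors share the coefficients and the separation
    argument. *)
Definition hull_up (T : finType) (a : T -> 'rV[R]_n) (D : {set T}) : set 'rV[R]_n :=
  [set x | exists lam : T -> R, [/\ forall t, 0 <= lam t,
     forall t, t \notin D -> lam t = 0, \sum_t lam t = 1 &
     forall i, \sum_t lam t * a t 0 i <= x 0 i]].

Section HullUp.
Variables (T : finType) (a : T -> 'rV[R]_n).
Implicit Types (D E : {set T}).

Lemma hull_up_gen D t : t \in D -> hull_up a D (a t).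
Proof.
move=> tD; exists (fun s => (s == t)%:R); split => [s|s|//|i].
- by rewrite ler0n.
- by case: eqP => // ->; rewrite tD.
- by rewrite (bigD1 t) //= eqxx big1 ?addr0 // => s /negPf->.
- rewrite (bigD1 t) //= eqxx mul1r big1 ?addr0 // => s /negPf->.
  by rewrite mul0r.
Qed.

Lemma hull_up_le D x y : hull_up a D x -> (forall i, x 0 i <= y 0 i) -> hull_up a D y.
Proof. by move=> [lam [l0 lD l1 lx]] xy; exists lam; split=> // i; apply: le_trans (xy i). Qed.

(** A point off the polyhedron fails every convex combination, so Gordan's
    alternative, applied to the [a t - p] and to the unit vectors, yields a
    separating weight; the unit vectors make it positive. *)
Lemma hull_up_sep D p : ~ hull_up a D p ->
  exists w, (forall i, 0 < w 0 i) /\ forall t, t \in D -> dot w p < dot w (a t).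
Proof.
move=> Hp.
pose b (z : T + 'I_n) := match z with inl t => a t - p | inr k => delta_mx 0 k end.
pose D' : {set T + 'I_n} := [set z : T + 'I_n | if z is inl t then t \in D else true]%SET.
have [[w Hw]|[lam [l0 lD [z1 lp] lb]]] := gordan b D'.
  exists w; split => [i|t tD].
    by have := Hw (inr i); rewrite inE dot_delta; apply.
  by have := Hw (inl t); rewrite inE tD /b dotBr subr_gt0; apply.
exfalso; apply: Hp; rewrite big_sumType /= in lb.
pose s := \sum_t lam (inl t).
have lbi i : \sum_t lam (inl t) * a t 0 i + lam (inr i) = s * p 0 i.
  move/rowP: lb => /(_ i); rewrite mxE !summxE mxE.
  rewrite [X in _ + X](bigD1 i) //= !mxE !eqxx mulr1 [X in _ + (_ + X)]big1 => [|k ki]; last first.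
    by rewrite !mxE eqxx /= eq_sym (negPf ki) mulr0.
  rewrite addr0 /s mulr_suml => h.
  apply/eqP; rewrite -subr_eq0 -[X in _ == X]h addrAC -sumrB; apply/eqP; congr (_ + _).
  by apply: eq_bigr => t _; rewrite !mxE; ring.
have s0 : 0 < s.
  rewrite lt_def sumr_ge0 // andbT; apply/negP => /eqP s0.
  have lt t : lam (inl t) = 0.
    apply/eqP; move/eqP: s0; rewrite psumr_eq0 // => /allP/(_ t (mem_index_enum _)); exact.
  have li i : lam (inr i) = 0.
    have := lbi i; rewrite s0 mul0r big1 ?add0r // => t _; by rewrite lt mul0r.
  by case: z1 lp => z; rewrite (lt, li) ltxx.
exists (fun t => lam (inl t) / s); split.
- by move=> t; rewrite divr_ge0 // ltW.
- by move=> t tD; rewrite lD ?mul0r // inE.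
- by rewrite -mulr_suml divff ?gt_eqF.
- move=> i; rewrite -(ler_pM2l s0) -lbi mulr_sumr -[leLHS]addr0.
  apply: lerD => //; apply: ler_sum => t _.
  by rewrite mulrA mulrCA mulfV ?gt_eqF // mulr1.
Qed.

Lemma convex_setP (C : set 'rV[R]_n) x y (k : R) :
  convex_set (C : set (convex_lmodType 'rV[R]_n)) -> C x -> C y -> 0 <= k -> k <= 1 ->
  C (k *: x + (1 - k) *: y).
Proof.
move=> cC Cx Cy k0 k1.
by have := cC x y (Itv01 k0 k1); rewrite !inE; apply.
Qed.

Lemma convex_set_sum (C : set 'rV[R]_n) (y : T -> 'rV[R]_n) D (lam : T -> R) :
  convex_set (C : set (convex_lmodType 'rV[R]_n)) -> (forall t, t \in D -> C (y t)) ->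
  (forall t, 0 <= lam t) -> (forall t, t \notin D -> lam t = 0) -> \sum_t lam t = 1 ->
  C (\sum_t lam t *: y t).
Proof.
move=> cC; move: {2}#|D| (erefl #|D|) => k; elim: k D lam => [|k IH] D lam cD yC l0 lD l1.
  move: l1; rewrite big1 => [/eqP|t _]; first by rewrite eq_sym oner_eq0.
  by apply: lD; rewrite (cards0_eq cD) inE.
have [t0 t0D] : exists t, t \in D by apply/card_gt0P; rewrite cD.
have cD' : #|D :\ t0| = k by apply/eqP; rewrite -eqSS -cD (cardsD1 t0 D) t0D.
have sum0 : \sum_(t | t != t0) lam t = 1 - lam t0.
  by rewrite -l1 [in RHS](bigD1 t0) //= addrC addrK.
have lt01 : lam t0 <= 1 by rewrite -subr_ge0 -sum0 sumr_ge0.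
rewrite (bigD1 t0) //=.
have [e1|n1] := eqVneq (lam t0) 1.
  rewrite e1 scale1r big1 ?addr0; first exact: yC.
  move=> t tt0; move: sum0; rewrite e1 subrr => /eqP; rewrite psumr_eq0 //.
  by move=> /allP/(_ t (mem_index_enum _)); rewrite tt0 => /eqP->; rewrite scale0r.
have p1 : 0 < 1 - lam t0 by rewrite subr_gt0 lt_neqAle n1.
pose mu t := if t == t0 then 0 else lam t / (1 - lam t0).
have -> : \sum_(t | t != t0) lam t *: y t = (1 - lam t0) *: \sum_t mu t *: y t.
  rewrite [in RHS](bigD1 t0) //= /mu eqxx scale0r add0r scaler_sumr.
  apply: eq_bigr => t /negPf->; rewrite scalerA mulrCA mulfV ?gt_eqF //.
  by rewrite mulr1.
apply: convex_setP => //; first exact: yC.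
apply: (IH (D :\ t0)) => //.
- by move=> t; rewrite !inE => /andP[_]; exact: yC.
- by move=> t; rewrite /mu; case: eqP => // _; rewrite divr_ge0 // ltW.
- move=> t; rewrite !inE /mu; case: eqP => //= _ tD.
  by rewrite lD // mul0r.
- rewrite (bigD1 t0) //= /mu eqxx add0r.
  under eq_bigr => t /negPf-> do [].
  by rewrite -mulr_suml sum0 divff // gt_eqF.
Qed.

Lemma hull_up_convex D : convex_set (hull_up a D : set (convex_lmodType 'rV[R]_n)).
Proof.
move=> x y k; rewrite !inE => -[l [l0 lD l1 lx]] [m [m0 mD m1 my]].
have k0 : 0 <= k%:num by [].
have k1 : 0 <= 1 - k%:num by rewrite subr_ge0.
exists (fun t => k%:num * l t + (1 - k%:num) * m t); split.
- by move=> t; rewrite addr_ge0 // mulr_ge0.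
- by move=> t tD; rewrite lD // mD // !mulr0 addr0.
- by rewrite big_split /= -!mulr_sumr l1 m1; ring.
- move=> i; rewrite !mxE.
  under eq_bigr do rewrite mulrDl -!mulrA.
  by rewrite big_split /= -!mulr_sumr lerD // ler_wpM2l.
Qed.

Lemma hull_up_sub D E : (forall t, t \in D -> hull_up a E (a t)) ->
  hull_up a D `<=` hull_up a E.
Proof.
move=> DE x [l [l0 lD l1 lx]].
apply: hull_up_le (convex_set_sum (@hull_up_convex E) DE l0 lD l1) _ => i.
by rewrite summxE; under eq_bigr do rewrite mxE.
Qed.

Lemma hull_up_valid D w l : (forall i, 0 <= w 0 i) ->
  (forall t, t \in D -> l <= dot w (a t)) -> valid_pair (hull_up a D) w l.
Proof.
move=> w0 lw x [lam [l0 lD l1 lx]].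
rewrite -[l]mul1r -l1 mulr_suml.
apply: (@le_trans _ _ (\sum_t lam t * dot w (a t))).
  apply: ler_sum => t _; have [tD|tD] := boolP (t \in D); last by rewrite lD // !mul0r.
  by apply: ler_wpM2l => //; exact: lw.
have -> : \sum_t lam t * dot w (a t) = dot w (\sum_t lam t *: a t).
  by rewrite dot_sumr; apply: eq_bigr => t _; rewrite dotZr.
by apply: dot_le => // i; rewrite summxE; under eq_bigr do rewrite mxE.
Qed.

(** A convex combination of numbers that are at least [l] equals [l] only if
    each number with a positive coefficient does. *)
Lemma hull_up_face_coef D w l x (lam : T -> R) : (forall i, 0 <= w 0 i) ->
  (forall t, t \in D -> l <= dot w (a t)) -> (forall t, 0 <= lam t) ->
  (forall t, t \notin D -> lam t = 0) -> \sum_t lam t = 1 ->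
  (forall i, \sum_t lam t * a t 0 i <= x 0 i) -> dot w x = l ->
  (forall t, lam t != 0 -> dot w (a t) = l) /\
  (forall i, w 0 i != 0 -> x 0 i = \sum_t lam t * a t 0 i).
Proof.
move=> w0 lw l0 lD l1 lx wx.
have e1 : \sum_t lam t * (dot w (a t) - l) + \sum_i w 0 i * (x 0 i - \sum_t lam t * a t 0 i) = 0.
  have -> : \sum_i w 0 i * (x 0 i - \sum_t lam t * a t 0 i) =
      dot w x - \sum_t lam t * dot w (a t).
    have -> : \sum_t lam t * dot w (a t) = dot w (\sum_t lam t *: a t).
      by rewrite dot_sumr; apply: eq_bigr => t _; rewrite dotZr.
    rewrite -dotBr; apply: eq_bigr => i _; rewrite !mxE summxE.
    by under [in RHS]eq_bigr do rewrite mxE.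
  have -> : \sum_t lam t * (dot w (a t) - l) = \sum_t lam t * dot w (a t) - l.
    by rewrite -[in RHS](mul1r l) -l1 mulr_suml -sumrB; apply: eq_bigr => t _; rewrite mulrBr.
  by rewrite wx; ring.
have p1 t : 0 <= lam t * (dot w (a t) - l).
  have [tD|tD] := boolP (t \in D); last by rewrite lD // mul0r.
  by rewrite mulr_ge0 // subr_ge0 lw.
have p2 i : 0 <= w 0 i * (x 0 i - \sum_t lam t * a t 0 i).
  by rewrite mulr_ge0 // subr_ge0.
move/eqP: e1; rewrite paddr_eq0 ?sumr_ge0 // => /andP[].
rewrite !psumr_eq0 // => /allP h1 /allP h2; split=> [t t0|i i0].
  have := h1 t (mem_index_enum _); rewrite mulf_eq0 (negPf t0) /= subr_eq0.
  by move/eqP.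
have := h2 i (mem_index_enum _); rewrite mulf_eq0 (negPf i0) /= subr_eq0.
by move/eqP.
Qed.

Lemma valid_ge0 D w l : D != finset.set0 -> valid_pair (hull_up a D) w l -> forall i, 0 <= w 0 i.
Proof.
case/set0Pn => t tD vw i; rewrite leNgt; apply/negP => wi.
have k0 : 0 <= (`|dot w (a t) - l| + 1) / - w 0 i.
  by rewrite divr_ge0 ?addr_ge0 // oppr_ge0 ltW.
have := vw (a t + ((`|dot w (a t) - l| + 1) / - w 0 i) *: delta_mx 0 i).
rewrite dotDr dotZr dot_delta invrN mulrN mulNr mulfVK ?lt_eqF // => h.
suff : l <= dot w (a t) + - (`|dot w (a t) - l| + 1).
  have := ler_norm (dot w (a t) - l); lra.
apply: h; apply: hull_up_le (hull_up_gen tD) _ => j.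
rewrite !mxE lerDl mulr_ge0 ?ler0n //.
by move: k0; rewrite invrN mulrN.
Qed.

Lemma exists_min_dot D w : D != finset.set0 ->
  exists2 t, t \in D & forall s, s \in D -> dot w (a t) <= dot w (a s).
Proof. by case/set0Pn => t0 t0D; case: (@arg_minP _ _ _ t0 (mem D) (fun t => dot w (a t)) t0D) => t tD h; exists t. Qed.

(** Discard redundant generators until none is left. Each remaining generator
    lies off the polyhedron of the others, and the weight that separates it
    exposes it as a vertex. *)
Lemma hull_up_vertices D : D != finset.set0 -> exists E : {set T},
  [/\ E \subset D, E != finset.set0, hull_up a E = hull_up a D &
      forall v, vertices (hull_up a D) v <-> exists2 t, t \in E & v = a t].
Proof.
move=> D0; pose P (E : {set T}) := `[< hull_up a E = hull_up a D >].
have PD : P D by apply/asboolP.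
have [E /minsetP[/asboolP PE minE] ED] := minset_exists PD.
have E0 : E != finset.set0.
  apply/negP => /eqP E0; case/set0Pn: D0 => t tD.
  have := hull_up_gen tD; rewrite -PE E0 => -[l [_ l0 l1 _]].
  move: l1; rewrite big1 => [/eqP|s _]; first by rewrite eq_sym oner_eq0.
  by apply: l0; rewrite inE.
exists E; split=> // v; rewrite -PE; split=> [[w [l [vw Fv _]]]|[t tE ->]].
  have [[lam [l0 lD l1 lx]] wv] : face_of (hull_up a E) w l v by rewrite -Fv.
  have w0 := valid_ge0 E0 vw.
  have lw t : t \in E -> l <= dot w (a t) by move=> tE; apply: vw; exact: hull_up_gen.
  have [h _] := hull_up_face_coef w0 lw l0 lD l1 lx wv.
  have [t lt] : exists t, lam t != 0.
    apply: contrapT => /forallNP h0; move: l1; rewrite big1 => [/eqP|s _].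
      by rewrite eq_sym oner_eq0.
    by apply/eqP; apply: contrapT => /negP; exact: h0.
  have tE : t \in E by apply: contraNT lt => /lD->.
  exists t => //.
  suff : [set v] (a t) by move=> /= ->.
  by rewrite Fv; split; [exact: hull_up_gen|exact: h].
have nt : ~ hull_up a (E :\ t) (a t).
  move=> ht; have : E :\ t = E.
    apply: minE; last exact: subsetDl.
    apply/asboolP; rewrite -PE; apply/seteqP; split; apply: hull_up_sub => s.
      by rewrite !inE => /andP[_]; exact: hull_up_gen.
    have [->//|st] := eqVneq s t.
    by move=> sE; apply: hull_up_gen; rewrite !inE st.
  by move/setP/(_ t); rewrite !inE eqxx tE.
have [w [wp wt]] := hull_up_sep nt.
have w0 i := ltW (wp i).
have lw s : s \in E -> dot w (a t) <= dot w (a s).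
  by have [->//|st] := eqVneq s t; move=> sE; apply/ltW/wt; rewrite !inE st.
exists w, (dot w (a t)); split; [exact: hull_up_valid| |by exists (a t)].
apply/seteqP; split => [_ ->|x [[lam [l0 lD l1 lx]] wx]].
  by split => //; exact: hull_up_gen.
have [h1 h2] := hull_up_face_coef w0 lw l0 lD l1 lx wx.
have ls s : s != t -> lam s = 0.
  move=> st; apply/eqP; apply: contraT => ls.
  have sE : s \in E by apply: contraNT ls => /lD->.
  by have := wt s; rewrite !inE st sE (h1 s ls) ltxx => /(_ isT).
move: l1; rewrite (bigD1 t) //= big1 // addr0 => lt.
apply/rowP => i; rewrite h2 ?gt_eqF // (bigD1 t) //= lt mul1r big1 ?addr0 // => s st.
by rewrite ls // mul0r.
Qed.

Lemma convex_hull_orthants (I : Type) (B : set I) (p : I -> 'rV[R]_n) D :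
  (forall t, t \in D -> exists2 b, B b & p b = a t) ->
  (forall b, B b -> exists2 t, t \in D & forall i, a t 0 i <= p b 0 i) ->
  convex_hull (\bigcup_(b in B) orthant_at (p b)) = hull_up a D.
Proof.
move=> DB BD; apply/seteqP; split.
  apply: smallest_sub; first exact: hull_up_convex.
  move=> x [b Bb [r r0 <-]]; have [t tD h] := BD b Bb.
  by apply: hull_up_le (hull_up_gen tD) _ => i; rewrite mxE ler_wpDr.
move=> x [lam [l0 lD l1 lx]] C [cC sC].
pose r := x - \sum_t lam t *: a t.
have -> : x = \sum_t lam t *: (a t + r).
  under eq_bigr do rewrite scalerDr.
  by rewrite big_split /= -scaler_suml l1 scale1r /r addrC subrK.
apply: (convex_set_sum cC _ l0 lD l1) => t tD.
have [b Bb <-] := DB t tD; apply: sC; exists b => //; exists r => // i.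
rewrite !mxE subr_ge0 summxE.
by under eq_bigr do rewrite mxE.
Qed.

Lemma hull_up_closed D : closed (hull_up a D).
Proof.
move=> x clx; apply: contrapT => nx; have [w [wp wx]] := hull_up_sep nx.
have [D0|D0] := eqVneq D finset.set0.
  have [y [[l [_ lD l1 _]] _]] := clx setT filterT.
  move: l1; rewrite big1 => [/eqP|s _]; first by rewrite eq_sym oner_eq0.
  by apply: lD; rewrite D0 inE.
have [t tD tm] := exists_min_dot w D0.
have [|y [/= hy /= yl]] := clx [set y | dot w y < dot w (a t)].
  have : \forall r \near dot w x, r < dot w (a t) by apply: lt_nbhsl; exact: wx.
  by move/(@dot_continuous R n w x).
have := hull_up_valid (fun i => ltW (wp i)) tm hy.
by rewrite leNgt yl.
Qed.

Lemma hull_up_face_compact D w l : (forall t i, 0 <= a t 0 i) ->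
  (forall i, 0 < w 0 i) -> compact (face_of (hull_up a D) w l).
Proof.
move=> a0 w0; apply: bounded_closed_compact; last first.
  apply: closedI; first exact: hull_up_closed.
  apply: (@closed_comp _ _ (dot w) [set l]); last exact: closed_eq.
  by move=> x _; exact: dot_continuous.
have [M hM] : exists M : R, forall i, l / w 0 i <= M.
  exists (\sum_i `|l / w 0 i|) => i; apply: le_trans (ler_norm _) _.
  by rewrite (bigD1 i) //= lerDl sumr_ge0.
exists (Num.max M 0); split => [|K MK x [[lam [l0 lD l1 lx]] wx]]; first exact: num_real.
have K0 : 0 <= K by apply: ltW; apply: le_lt_trans MK; rewrite le_max lexx orbT.
have x0 i : 0 <= x 0 i by apply: le_trans (lx i); apply: sumr_ge0 => t _; rewrite mulr_ge0.
rewrite /= /Num.Def.normr /= mx_normrE; apply: bigmax_le => // -[i j] _ /=.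
rewrite (ord1 i) ger0_norm //; apply: le_trans (ltW MK).
rewrite le_max; apply/orP; left; apply: le_trans (hM j).
rewrite ler_pdivlMr // -wx /dot (bigD1 j) //= mulrC lerDl.
by apply: sumr_ge0 => k _; rewrite mulr_ge0 // ltW.
Qed.

End HullUp.
End Polyhedron.

(** * Dickson's lemma *)

(** By induction on the set of coordinates in which domination
    is required. The members whose coordinate [i] is at least [M], a bound for
    that coordinate on the representatives obtained for [s], are dominated by
    these; the others split into finitely many classes of constant [i]-th
    coordinate. *)
Lemma dickson_coords (n : nat) (s : seq 'I_n) (S : set {ffun 'I_n -> nat}) :
  exists N : nat, forall a, S a -> exists2 b, S b &
    (forall i, i \in s -> (b i <= a i)%N) /\ (forall i, (b i <= N)%N).
Proof.
elim: s S => [|i s IH] S.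
  have [[b Sb]|nS] := pselect (exists b, S b); last by exists 0%N => a Sa; case: nS; exists a.
  exists (\max_i b i)%N => a _; exists b => //; split=> // i.
  exact: leq_bigmax.
have [M HM] := IH S.
pose Sm (m : nat) := [set a | S a /\ a i = m].
have [K HK] := choice (fun m => IH (Sm m)).
exists (maxn M (\max_(m < M) K m)) => a Sa.
have [aM|Ma] := ltnP (a i) M.
  have [b [Sb bi] [b1 b2]] := HK (a i) a (conj Sa erefl).
  exists b => //; split => j; last first.
    apply: leq_trans (b2 j) _; rewrite leq_max; apply/orP; right.
    exact: (leq_bigmax (Ordinal aM)).
  by rewrite inE => /predU1P[->|/b1//]; rewrite bi.
have [b Sb [b1 b2]] := HM a Sa; exists b => //; split => j.
  by rewrite inE => /predU1P[->|/b1//]; exact: leq_trans (b2 i) Ma.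
by rewrite leq_max b2.
Qed.

Lemma dickson (n : nat) (S : set {ffun 'I_n -> nat}) :
  exists N : nat, forall a, S a -> exists2 b, S b &
    (forall i, (b i <= a i)%N) /\ (forall i, (b i <= N)%N).
Proof.
have [N HN] := dickson_coords (enum 'I_n) S; exists N => a /HN[b Sb [b1 b2]].
by exists b => //; split => // i; apply: b1; rewrite mem_enum.
Qed.

(** * Smooth functions on a cube *)

Section Calculus.
Context {R : realType} {n : nat}.
Implicit Types (x y : 'rV[R]_n) (f g h : 'rV[R]_n -> R) (i j : 'I_n) (r : R).

Definition cube r : set 'rV[R]_n := [set x | forall i, `|x 0 i| < r].

Definition upd x i (t : R) : 'rV[R]_n := \row_j (if j == i then t else x 0 j).

Lemma updii x i t : upd x i t 0 i = t.
Proof. by rewrite mxE eqxx. Qed.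

Lemma updij x i j t : j != i -> upd x i t 0 j = x 0 j.
Proof. by rewrite mxE => /negPf->. Qed.

Lemma upd_id x i : upd x i (x 0 i) = x.
Proof. by apply/rowP => j; rewrite mxE; case: eqP => [->|]. Qed.

Lemma upd_upd x i s t : upd (upd x i s) i t = upd x i t.
Proof. by apply/rowP => j; rewrite !mxE; case: eqP. Qed.

Lemma updC x i j s t : i != j -> upd (upd x i s) j t = upd (upd x j t) i s.
Proof.
move=> ij; apply/rowP => k; rewrite !mxE.
by case: eqP => [->|//]; rewrite eq_sym (negPf ij).
Qed.

Lemma cube_nbhs r x : cube r x -> \forall y \near x, cube r y.
Proof.
move=> rx; apply: (@filter_forall _ _ (fun i (y : 'rV[R]_n) => `|y 0 i| < r) (nbhs x) _) => i.
have : \forall z \near x 0 i, `|z| < r.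
  by apply: (@cvgr_lt _ _ _ _ _ _ (@norm_continuous _ R^o (x 0 i))).
by move/(@coord_continuous R 1 n 0 i x).
Qed.

Lemma cube_near0 r : 0 < r -> \forall x \near (0 : 'rV[R]_n), cube r x.
Proof. by move=> r0; apply: cube_nbhs => i; rewrite mxE normr0. Qed.

Lemma near0_cube (P : set 'rV[R]_n) : (\forall x \near (0 : 'rV[R]_n), P x) ->
  exists2 r, 0 < r & cube r `<=` P.
Proof.
case/nbhs_ballP => r /= r0 rP; exists r => // x rx; apply: rP; split=> // i j.
by rewrite (ord1 i) mxE -ball_normE /= sub0r normrN.
Qed.

Lemma cube_le r r' x : r <= r' -> cube r x -> cube r' x.
Proof. by move=> rr' rx i; apply: lt_le_trans rr'. Qed.

Lemma cube_upd r x i t : cube r x -> `|t| < r -> cube r (upd x i t).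
Proof. by move=> rx tr j; rewrite mxE; case: ifP. Qed.

Lemma cube_upd0 r x i : cube r x -> cube r (upd x i 0).
Proof.
move=> rx; apply: cube_upd => //; rewrite normr0.
by apply: le_lt_trans (rx i).
Qed.

(** Directional derivatives along a unit vector are derivatives of one-variable
    functions; this reduces the rules below to one-variable calculus. *)
Lemma upd_growth_rate f x i t :
  (fun s : R => s^-1 *: ((f \o shift (upd x i t)) (s *: delta_mx 0 i) - f (upd x i t))) =
  (fun s : R => s^-1 *: (((fun t => f (upd x i t)) \o shift t) (s *: 1) - f (upd x i t))).
Proof.
apply/funext => s /=; congr (_ *: (f _ - _)); apply/rowP => j; rewrite !mxE /=.
by case: eqP => _; rewrite ?mulr0 ?add0r // mulr1 [_ *: 1]mulr1.
Qed.

Lemma derivable_upd f x i t :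
  derivable f (upd x i t) (delta_mx 0 i) = derivable (fun t => f (upd x i t)) t 1.
Proof. by rewrite /derivable upd_growth_rate. Qed.

Lemma partial_upd f x i t : partial i f (upd x i t) = 'D_1 (fun t => f (upd x i t)) t.
Proof. by rewrite /partial /derive upd_growth_rate. Qed.

Lemma derivable_slice f x i (phi : R -> R) : (forall t, f (upd x i t) = phi t) ->
  derivable f x (delta_mx 0 i) = derivable phi (x 0 i) 1.
Proof. by move=> /funext <-; rewrite -derivable_upd upd_id. Qed.

Lemma partial_slice f x i (phi : R -> R) : (forall t, f (upd x i t) = phi t) ->
  partial i f x = 'D_1 phi (x 0 i).
Proof. by move=> /funext <-; rewrite -partial_upd upd_id. Qed.

(** Regularity of order [k] is defined by recursion on [k], so that the closure
    properties below are inductions that need no formula for higher derivatives. *)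
Fixpoint Ck (k : nat) r f : Prop :=
  (forall x, cube r x -> {for x, continuous f}) /\
  if k is k'.+1 then forall i, (forall x, cube r x -> derivable f x (delta_mx 0 i)) /\
    Ck k' r (partial i f)
  else True.

Definition smooth r f := forall k, Ck k r f.

Definition eqc r f g := forall x, cube r x -> f x = g x.

Lemma eqc_trans r f g h : eqc r f g -> eqc r g h -> eqc r f h.
Proof. by move=> fg gh x rx; rewrite fg // gh. Qed.

Lemma eqc_near r f g x : eqc r f g -> cube r x -> \near x, f x = g x.
Proof. by move=> fg rx; near=> y; apply: fg; near: y; exact: cube_nbhs. Unshelve. all: by end_near. Qed.

Lemma eqc_continuous r f g x : eqc r f g -> cube r x ->
  {for x, continuous f} -> {for x, continuous g}.
Proof.
move=> fg rx cf; suff : g y @[y --> x] --> f x by rewrite fg.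
exact: cvg_trans (@near_eq_cvg _ _ (nbhs x) _ f g (eqc_near fg rx)) cf.
Qed.

Lemma eqc_partial r i f g : eqc r f g -> eqc r (partial i f) (partial i g).
Proof. by move=> fg x rx; apply: near_eq_derive; exact: eqc_near rx. Qed.

Lemma eqc_iter_partial r i k f g : eqc r f g ->
  eqc r (iter k (partial i) f) (iter k (partial i) g).
Proof. by move=> fg; elim: k => //= k; exact: eqc_partial. Qed.

Lemma Ck_eqc k r f g : eqc r f g -> Ck k r f -> Ck k r g.
Proof.
elim: k f g => [|k IH] f g fg [cf df].
all: have cg x : cube r x -> {for x, continuous g}
  by move=> rx; apply: (eqc_continuous fg rx); exact: cf.
- by split.
- split=> // i; have [df1 df2] := df i; split => [x rx|].
    by apply: near_eq_derivable (df1 x rx); exact: eqc_near rx.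
  by apply: IH df2; exact: eqc_partial.
Qed.

Lemma smooth_eqc r f g : eqc r f g -> smooth r f -> smooth r g.
Proof. by move=> fg sf k; exact: Ck_eqc (sf k). Qed.

Lemma CkS k r f : Ck k.+1 r f -> Ck k r f.
Proof.
elim: k f => [|k IH] f [cf df]; first by split.
by split=> // i; have [df1 df2] := df i; split=> //; exact: IH.
Qed.

Lemma Ck_le k r r' f : r' <= r -> Ck k r f -> Ck k r' f.
Proof.
move=> rr'; elim: k f => [|k IH] f [cf df].
  by split=> // x rx; apply: cf; exact: cube_le rx.
split=> [x rx|i]; first by apply: cf; exact: cube_le rx.
have [df1 df2] := df i; split=> [x rx|]; last exact: IH.
by apply: df1; exact: cube_le rx.
Qed.

Lemma smooth_le r r' f : r' <= r -> smooth r f -> smooth r' f.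
Proof. by move=> rr' sf k; exact: Ck_le (sf k). Qed.

Lemma smooth_continuous r f x : smooth r f -> cube r x -> {for x, continuous f}.
Proof. by move=> /(_ 0%N)[cf _] /cf. Qed.

Lemma smooth_derivable r f x i : smooth r f -> cube r x -> derivable f x (delta_mx 0 i).
Proof. by move=> /(_ 1%N)[_ /(_ i)[df _]] /df. Qed.

Lemma smooth_partial r f i : smooth r f -> smooth r (partial i f).
Proof. by move=> sf k; have [_ /(_ i)[]] := sf k.+1. Qed.

Lemma smooth_iter_partial r f i k : smooth r f -> smooth r (iter k (partial i) f).
Proof. by move=> sf; elim: k => //= k; exact: smooth_partial. Qed.

Lemma smooth_iter_partial_seq r f s : smooth r f -> smooth r (iter_partial s f).
Proof. by move=> sf; elim: s => //= i s; exact: smooth_partial. Qed.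

Lemma smooth_on_smooth (U : set 'rV[R]_n) r f : cube r `<=` U -> smooth_on U f -> smooth r f.
Proof.
move=> rU sf k; rewrite (_ : f = iter_partial [::] f) //.
elim: k [::] => [|k IH] s; first by split=> // x /rU Ux; exact: (sf s x Ux).1.
split=> [x /rU Ux|i]; first exact: (sf s x Ux).1.
split=> [x /rU Ux|]; first exact: (sf s x Ux).2.
exact: (IH (i :: s)).
Qed.

Lemma smooth_smooth_on r f : smooth r f -> smooth_on (cube r) f.
Proof.
move=> sf s x rx; have ss := smooth_iter_partial_seq s sf.
by split=> [|i]; [exact: smooth_continuous rx|exact: smooth_derivable rx].
Qed.

Lemma partialD r f g i : smooth r f -> smooth r g ->
  eqc r (partial i (fun x => f x + g x)) (fun x => partial i f x + partial i g x).
Proof.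
by move=> sf sg x rx; apply: (@deriveD R _ _ f g); exact: smooth_derivable rx.
Qed.

Lemma Ck_add k r f g : Ck k r f -> Ck k r g -> Ck k r (fun x => f x + g x).
Proof.
elim: k f g => [|k IH] f g [cf df] [cg dg].
all: have cfg x : cube r x -> {for x, continuous (fun x => f x + g x)}
  by move=> rx; apply: (@continuousD R R^o); [exact: cf|exact: cg].
- by split.
- split=> // i; have [df1 df2] := df i; have [dg1 dg2] := dg i; split => [x rx|].
    by apply: derivableD; [exact: df1|exact: dg1].
  apply: Ck_eqc (IH _ _ df2 dg2) => x rx; apply/esym/deriveD; [exact: df1|exact: dg1].
Qed.

Lemma Ck_mul k r f g : Ck k r f -> Ck k r g -> Ck k r (fun x => f x * g x).
Proof.
elim: k f g => [|k IH] f g Cf Cg; have [cf df] := Cf; have [cg dg] := Cg.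
all: have cfg x : cube r x -> {for x, continuous (fun x => f x * g x)}
  by move=> rx; apply: continuousM; [exact: cf|exact: cg].
- by split.
- split=> // i; have [df1 df2] := df i; have [dg1 dg2] := dg i; split => [x rx|].
    by apply: derivableM; [exact: df1|exact: dg1].
  apply: Ck_eqc (Ck_add (IH _ _ (CkS Cf) dg2) (IH _ _ (CkS Cg) df2)) => x rx.
  apply/esym/deriveM; [exact: df1|exact: dg1].
Qed.

Lemma partial_cst i (c : R) x : partial i (fun=> c) x = 0.
Proof. exact: derive_cst. Qed.

Lemma smooth_cst r (c : R) : smooth r (fun=> c).
Proof.
move=> k; elim: k c => [|k IH] c; (split; first by move=> x _; exact: cst_continuous) => // i.
split=> [x _|]; first exact: derivable_cst.
by apply: Ck_eqc (IH 0) => x _; rewrite partial_cst.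
Qed.

Lemma partial_coord i j x : partial i (fun x => x 0 j) x = (j == i)%:R.
Proof.
have [<-|ji] := eqVneq j i.
  by rewrite (@partial_slice _ x j id) ?derive_id // => t; exact: updii.
by rewrite (@partial_slice _ x i (cst (x 0 j))) ?derive_cst // => t; exact: updij.
Qed.

Lemma smooth_coord r j : smooth r (fun x => x 0 j).
Proof.
case=> [|k]; (split; first by move=> x _; exact: coord_continuous) => // i.
split=> [x _|].
  have [<-|ji] := eqVneq j i.
    by rewrite (@derivable_slice _ x j id) // => t; exact: updii.
  by rewrite (@derivable_slice _ x i (cst (x 0 j))) // => t; exact: updij.
by apply: Ck_eqc (smooth_cst r (j == i)%:R k) => x _; rewrite partial_coord.
Qed.

Lemma smoothD r f g : smooth r f -> smooth r g -> smooth r (fun x => f x + g x).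
Proof. by move=> sf sg k; exact: Ck_add. Qed.

Lemma smoothM r f g : smooth r f -> smooth r g -> smooth r (fun x => f x * g x).
Proof. by move=> sf sg k; exact: Ck_mul. Qed.

Lemma smoothZ r (c : R) f : smooth r f -> smooth r (fun x => c * f x).
Proof. by apply: smoothM; exact: smooth_cst. Qed.

Lemma smoothB r f g : smooth r f -> smooth r g -> smooth r (fun x => f x - g x).
Proof.
move=> sf sg; under eq_fun do rewrite -mulN1r.
by apply: smoothD => //; exact: smoothZ.
Qed.

Lemma smooth_sum r (I : Type) (s : seq I) (F : I -> 'rV[R]_n -> R) :
  (forall k, smooth r (F k)) -> smooth r (fun x => \sum_(k <- s) F k x).
Proof.
move=> sF; elim: s => [|k s IH].
  by under eq_fun do rewrite big_nil; exact: smooth_cst.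
by under eq_fun do rewrite big_cons; exact: smoothD.
Qed.

Lemma smooth_prod r (I : Type) (s : seq I) (F : I -> 'rV[R]_n -> R) :
  (forall k, smooth r (F k)) -> smooth r (fun x => \prod_(k <- s) F k x).
Proof.
move=> sF; elim: s => [|k s IH].
  by under eq_fun do rewrite big_nil; exact: smooth_cst.
by under eq_fun do rewrite big_cons; exact: smoothM.
Qed.

Lemma smooth_coordX r i k : smooth r (fun x => x 0 i ^+ k).
Proof.
elim: k => [|k IH]; first by under eq_fun do rewrite expr0; exact: smooth_cst.
by under eq_fun do rewrite exprS; apply: smoothM => //; exact: smooth_coord.
Qed.

Lemma smooth_monomial r a : smooth r (monomial a).
Proof. by apply: smooth_prod => i; exact: smooth_coordX. Qed.

Lemma partialB r f g i : smooth r f -> smooth r g ->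
  eqc r (partial i (fun x => f x - g x)) (fun x => partial i f x - partial i g x).
Proof. by move=> sf sg x rx; apply: (@deriveB R _ _ f g); exact: smooth_derivable rx. Qed.

Lemma partial_sum r (I : Type) (s : seq I) (F : I -> 'rV[R]_n -> R) i :
  (forall k, smooth r (F k)) ->
  eqc r (partial i (fun x => \sum_(k <- s) F k x)) (fun x => \sum_(k <- s) partial i (F k) x).
Proof.
move=> sF; elim: s => [|k s IH] x rx.
  by under [in LHS]eq_fun do rewrite big_nil; rewrite partial_cst big_nil.
under [in LHS]eq_fun do rewrite big_cons.
by rewrite (partialD i (sF k) (smooth_sum s sF) rx) IH // big_cons.
Qed.

(** A factor that does not depend on the variable [i] goes through the partial
    derivative in that variable. *)
Lemma partial_constM r f (M : 'rV[R]_n -> R) i : (forall x t, M (upd x i t) = M x) ->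
  smooth r f -> eqc r (partial i (fun x => M x * f x)) (fun x => M x * partial i f x).
Proof.
move=> Mi sf x rx.
rewrite (@partial_slice _ x i (fun t => M x * f (upd x i t))) => [|t]; last by rewrite Mi.
rewrite (@partial_slice f x i (fun t => f (upd x i t))) //.
apply: (@deriveMl R R (fun t => f (upd x i t))).
by rewrite -derivable_upd upd_id; exact: smooth_derivable rx.
Qed.

Lemma upd0_continuous i : continuous (fun x => upd x i 0).
Proof.
move=> x A /nbhs_ballP[e /= e0 eA]; apply/nbhs_ballP; exists e => // y [_ xy].
apply: eA; split=> // k j; rewrite (ord1 k) !mxE.
by case: eqP => _; [exact: ballxx|exact: xy].
Qed.

Lemma partial_upd0_neq f i j x : j != i ->
  partial j (fun x => f (upd x i 0)) x = partial j f (upd x i 0).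
Proof.
move=> ji; rewrite (@partial_slice _ x j (fun t => f (upd (upd x i 0) j t))) => [|t].
  by rewrite -partial_upd -(updij x 0 ji) upd_id.
by rewrite updC.
Qed.

Lemma partial_upd0_eq f i x : partial i (fun x => f (upd x i 0)) x = 0.
Proof.
rewrite (@partial_slice _ x i (cst (f (upd x i 0)))) ?derive_cst // => t.
by rewrite upd_upd.
Qed.

Lemma smooth_upd0 r f i : smooth r f -> smooth r (fun x => f (upd x i 0)).
Proof.
move=> sf k; elim: k f sf => [|k IH] f sf.
all: have c x : cube r x -> {for x, continuous (fun x => f (upd x i 0))}
  by move=> rx; apply: (@continuous_comp _ _ _ (fun x => upd x i 0) f);
    [exact: upd0_continuous|apply: (smooth_continuous sf); exact: cube_upd0].
- by split.
- split=> // j; have [->|ji] := eqVneq j i; [split=> [x rx|]|split=> [x rx|]].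
  + rewrite (@derivable_slice _ x i (cst (f (upd x i 0)))) // => t.
    by rewrite upd_upd.
  + by apply: Ck_eqc (smooth_cst r 0 k) => x _; rewrite partial_upd0_eq.
  + rewrite (@derivable_slice _ x j (fun t => f (upd (upd x i 0) j t))) => [|t].
      rewrite -derivable_upd -(updij x 0 ji) upd_id.
      by apply: (smooth_derivable sf); exact: cube_upd0.
    by rewrite updC.
  + by apply: Ck_eqc (IH _ (smooth_partial j sf)) => x _; rewrite partial_upd0_neq.
Qed.

(** * Mean value theorem and symmetry of second derivatives *)

Lemma mvt_upd r f x i (a b : R) : smooth r f -> a <= b ->
  (forall c, a <= c <= b -> cube r (upd x i c)) ->
  exists2 c, a <= c <= b &
    f (upd x i b) - f (upd x i a) = partial i f (upd x i c) * (b - a).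
Proof.
move=> sf ab rx.
have df c : a <= c <= b -> derivable (fun t => f (upd x i t)) c 1.
  by move=> /rx rc; rewrite -derivable_upd; exact: smooth_derivable rc.
have [||c cab ->] := @MVT_segment R (fun t => f (upd x i t))
    (fun t => partial i f (upd x i t)) a b ab.
- move=> c; rewrite in_itv /= => /andP[ac cb]; rewrite partial_upd.
  by apply: derivableP; apply: df; rewrite !ltW.
- by apply: derivable_within_continuous => c; rewrite in_itv /=; exact: df.
- by exists c => //; move: cab; rewrite in_itv.
Qed.

(** The second difference over a small square with sides along [i] and [j], by
    the mean value theorem in [i] and then in [j]. *)
Lemma second_difference r f x i j (s : R) : i != j -> smooth r f -> 0 < s ->
  (forall c, 0 <= c <= s -> forall d, 0 <= d <= s ->
     cube r (upd (upd x i (x 0 i + c)) j (x 0 j + d))) ->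
  exists c d, [/\ 0 <= c <= s, 0 <= d <= s &
    f (upd (upd x i (x 0 i + s)) j (x 0 j + s)) - f (upd x i (x 0 i + s))
    - (f (upd x j (x 0 j + s)) - f x) =
    partial j (partial i f) (upd (upd x i (x 0 i + c)) j (x 0 j + d)) * s * s].
Proof.
move=> ij sf s0 rs.
have df b c : 0 <= b <= s -> 0 <= c <= s ->
    derivable (fun t => f (upd (upd x i t) j (x 0 j + b))) (x 0 i + c) 1.
  move=> bs cs; have := @smooth_derivable r f _ i sf (rs c cs b bs).
  rewrite (@derivable_slice f _ i (fun t => f (upd (upd x i t) j (x 0 j + b)))).
    by rewrite updij // updii.
  by move=> t; rewrite updC 1?eq_sym // upd_upd.
have ss : 0 <= s <= s by rewrite lexx ltW.
have s00 : 0 <= (0 : R) <= s by rewrite lexx ltW.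
have upd0 t : upd (upd x i t) j (x 0 j + 0) = upd x i t.
  by rewrite addr0 updC // upd_id.
pose F t := f (upd (upd x i t) j (x 0 j + s)) - f (upd (upd x i t) j (x 0 j + 0)).
have dF c : 0 <= c <= s -> derivable F (x 0 i + c) 1.
  by move=> cs; apply: derivableB; exact: df.
have xs : x 0 i <= x 0 i + s by rewrite lerDl ltW.
have shift c : x 0 i <= c <= x 0 i + s -> 0 <= c - x 0 i <= s.
  by move=> /andP[h1 h2]; rewrite subr_ge0 h1 lerBlDl.
have [||c /shift cs Fc] := @MVT_segment R F (fun t => 'D_1 F t) _ _ xs.
- move=> c; rewrite in_itv /= => /andP[h1 h2]; apply: derivableP.
  by rewrite -(subrKC (x 0 i) c); apply: dF; apply: shift; rewrite !ltW.
- apply: derivable_within_continuous => c; rewrite in_itv /= => h.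
  by rewrite -(subrKC (x 0 i) c); apply: dF; apply: shift.
have F1 : F (x 0 i + s) - F (x 0 i) =
   f (upd (upd x i (x 0 i + s)) j (x 0 j + s)) - f (upd x i (x 0 i + s))
    - (f (upd x j (x 0 j + s)) - f x).
  by rewrite /F !upd0 upd_id.
have dFc : 'D_1 F c = partial i f (upd (upd x i c) j (x 0 j + s)) -
                      partial i f (upd (upd x i c) j (x 0 j + 0)).
  rewrite /F deriveB; last 2 first.
  - by rewrite -(subrKC (x 0 i) c); exact: df.
  - by rewrite -(subrKC (x 0 i) c); exact: df.
  have slice b : 'D_1 (fun t => f (upd (upd x i t) j (x 0 j + b))) c =
      partial i f (upd (upd x i c) j (x 0 j + b)).
    rewrite (@partial_slice f _ i (fun t => f (upd (upd x i t) j (x 0 j + b)))).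
      by rewrite updij // updii.
    by move=> t; rewrite updC 1?eq_sym // upd_upd.
  by rewrite !slice.
rewrite -F1 Fc dFc.
have js : x 0 j + 0 <= x 0 j + s by rewrite lerD2l ltW.
have cE : c = x 0 i + (c - x 0 i) by rewrite subrKC.
have [|d ds ->] := mvt_upd (x := upd x i c) (i := j) (smooth_partial i sf) js.
  move=> d /andP[h1 h2]; rewrite -(subrKC (x 0 j) d) cE; apply: rs => //.
  by apply/andP; split; lra.
exists (c - x 0 i), (d - x 0 j); split=> //.
  by move: ds => /andP[h1 h2]; apply/andP; split; lra.
by rewrite !subrKC; congr (_ * _ * _); ring.
Qed.

(** The second difference is symmetric in [i] and [j]; divided by the area of the
    square it is a value of either mixed derivative nearby, and both are
    continuous. *)
Lemma partialC r f i j : smooth r f ->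
  eqc r (partial i (partial j f)) (partial j (partial i f)).
Proof.
move=> sf x rx; have [->//|ij] := eqVneq i j.
have near_eps g (e : R) : smooth r g -> 0 < e ->
    \forall s \near (0 : R)^'+, forall c d, 0 <= c <= s -> 0 <= d <= s ->
      `|g x - g (upd (upd x i (x 0 i + c)) j (x 0 j + d))| < e /\
      cube r (upd (upd x i (x 0 i + c)) j (x 0 j + d)).
  move=> sg e0; have cg := smooth_continuous sg rx.
  have : \forall y \near x, `|g x - g y| < e /\ cube r y.
    apply: filterI; last exact: cube_nbhs.
    by move/cvgrPdist_lt : cg => /(_ e e0).
  case/nbhs_ballP => d /= d0 hd; near=> s => c c' /andP[c0 cs] /andP[c'0 c's].
  apply: hd; split=> // k l; rewrite (ord1 k) -ball_normE /= !mxE.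
  have sd : s < d by near: s; exact: nbhs_right_lt.
  case: eqP => [->|_]; [|case: eqP => [->|_]].
  - by rewrite opprD addrA subrr sub0r normrN ger0_norm // (le_lt_trans c's).
  - by rewrite opprD addrA subrr sub0r normrN ger0_norm // (le_lt_trans cs).
  - by rewrite subrr normr0.
apply/eqP; rewrite -subr_eq0 -normr_le0; apply/ler_addgt0Pr => e e0; rewrite add0r.
have e2 : 0 < e / 2 by rewrite divr_gt0.
have h1 := near_eps _ _ (smooth_partial i (smooth_partial j sf)) e2.
have h2 := near_eps _ _ (smooth_partial j (smooth_partial i sf)) e2.
have [s [s0 hs1 hs2]] : exists s : R, [/\ 0 < s,
   forall c d, 0 <= c <= s -> 0 <= d <= s ->
      `|partial i (partial j f) x -
        partial i (partial j f) (upd (upd x i (x 0 i + c)) j (x 0 j + d))| < e / 2 /\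
      cube r (upd (upd x i (x 0 i + c)) j (x 0 j + d)) &
   forall c d, 0 <= c <= s -> 0 <= d <= s ->
      `|partial j (partial i f) x -
        partial j (partial i f) (upd (upd x i (x 0 i + c)) j (x 0 j + d))| < e / 2 /\
      cube r (upd (upd x i (x 0 i + c)) j (x 0 j + d))].
  have [s hs] := filter_ex (filterI (nbhs_right_gt 0) (filterI h1 h2)).
  by exists s; case: hs => ? [? ?].
have [|c [d [cs ds E1]]] := @second_difference r f x i j s ij sf s0.
  by move=> c cs d ds; exact: (hs1 c d cs ds).2.
have ji : j != i by rewrite eq_sym.
have [|c' [d' [cs' ds' E2]]] := @second_difference r f x j i s ji sf s0.
  by move=> c' cs' d' ds'; rewrite updC //; exact: (hs1 _ _ ds' cs').2.
rewrite !(updC x _ _ ji) in E2.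
have sub4 (u v w z : R) : u - v - (w - z) = u - w - (v - z) by ring.
have ss0 : s * s != 0 by rewrite mulf_neq0 // gt_eqF.
have E (A B u v w z : R) : u - v - (w - z) = A * s * s -> u - w - (v - z) = B * s * s -> A = B.
  by move=> h3 h4; apply: (mulIf ss0); rewrite !mulrA -h3 -h4 sub4.
have [k1 _] := hs1 _ _ ds' cs'; have [k2 _] := hs2 _ _ cs ds.
rewrite {E}(E _ _ _ _ _ _ E1 E2) in k2.
rewrite -(subrK (partial i (partial j f) (upd (upd x i (x 0 i + d')) j (x 0 j + c')))
   (partial i (partial j f) x)) -addrA.
apply: le_trans (ler_normD _ _) _; rewrite [X in _ + X]distrC.
by rewrite [leRHS]splitr; apply: lerD; apply: ltW; [exact: k1|exact: k2].
Unshelve. all: by end_near. Qed.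

Lemma iter_partialC r f i j k : smooth r f ->
  eqc r (partial j (iter k (partial i) f)) (iter k (partial i) (partial j f)).
Proof.
move=> sf; elim: k => //= k IH.
apply: eqc_trans (eqc_partial i IH).
by apply: partialC; exact: smooth_iter_partial.
Qed.

Lemma iter_iter_partialC r f i j k m : smooth r f ->
  eqc r (iter m (partial j) (iter k (partial i) f)) (iter k (partial i) (iter m (partial j) f)).
Proof.
move=> sf; elim: m => //= m IH.
apply: eqc_trans (eqc_partial j IH) _.
by apply: iter_partialC; exact: smooth_iter_partial.
Qed.

End Calculus.

(** * Taylor expansion in several variables, one variable at a time *)

Section Taylor.
Context {R : realType} {n : nat}.
Implicit Types (x y : 'rV[R]_n) (f g h : 'rV[R]_n -> R) (i j : 'I_n) (r : R).
Implicit Types (N k m : nat) (q : {ffun 'I_n -> nat}) (s : seq 'I_n).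

Definition tayl i k f : 'rV[R]_n -> R :=
  fun x => x 0 i ^+ k / (k`!)%:R * iter k (partial i) f (upd x i 0).

Definition rem N i f : 'rV[R]_n -> R := fun x => f x - \sum_(k < N) tayl i k f x.

(** The index [N] is used for the remainder, so that the parts of an expansion are
    indexed by multi-indices bounded by [N]. *)
Definition term N i k f : 'rV[R]_n -> R :=
  if (k < N)%N then tayl i k f else rem N i f.

Lemma smooth_tayl r i k f : smooth r f -> smooth r (tayl i k f).
Proof.
move=> sf; apply: smoothM; first by apply: smoothM; [exact: smooth_coordX|exact: smooth_cst].
exact: (smooth_upd0 i (smooth_iter_partial i k sf)).
Qed.

Lemma smooth_rem r N i f : smooth r f -> smooth r (rem N i f).
Proof.
move=> sf; apply: smoothB => //; apply: (smooth_sum _ (fun k : 'I_N => smooth_tayl i k sf)).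
Qed.

Lemma smooth_term r N i k f : smooth r f -> smooth r (term N i k f).
Proof. by move=> sf; rewrite /term; case: ifP => _; [exact: smooth_tayl|exact: smooth_rem]. Qed.

Lemma tayl_eqc r i k f g : eqc r f g -> eqc r (tayl i k f) (tayl i k g).
Proof.
by move=> fg x rx; rewrite /tayl (eqc_iter_partial i k fg) //; exact: cube_upd0.
Qed.

Lemma rem_eqc r N i f g : eqc r f g -> eqc r (rem N i f) (rem N i g).
Proof.
move=> fg x rx; rewrite /rem fg //; congr (_ - _); apply: eq_bigr => k _.
exact: tayl_eqc rx.
Qed.

Lemma term_eqc r N i k f g : eqc r f g -> eqc r (term N i k f) (term N i k g).
Proof. by move=> fg; rewrite /term; case: ifP => _; [exact: tayl_eqc|exact: rem_eqc]. Qed.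

Lemma partial_tayl_neq r i j k f : j != i -> smooth r f ->
  eqc r (partial j (tayl i k f)) (tayl i k (partial j f)).
Proof.
move=> ji sf x rx; rewrite /tayl.
have sg := smooth_upd0 i (smooth_iter_partial i k sf).
have Mj (y : 'rV[R]_n) (t : R) : upd y j t 0 i ^+ k / (k`!)%:R = y 0 i ^+ k / (k`!)%:R.
  by rewrite updij // eq_sym.
rewrite (partial_constM Mj sg rx) partial_upd0_neq //; congr (_ * _).
by apply: (iter_partialC _ _ _ sf); exact: cube_upd0.
Qed.

Lemma partial_tayl0 i f x : partial i (tayl i 0 f) x = 0.
Proof.
rewrite (@partial_slice _ _ _ x i (cst (f (upd x i 0)))) ?derive_cst // => t.
by rewrite /tayl /= expr0 fact0 divr1 mul1r upd_upd.
Qed.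

Lemma partial_taylS i k f x : partial i (tayl i k.+1 f) x = tayl i k (partial i f) x.
Proof.
set c := iter k (partial i) (partial i f) (upd x i 0).
rewrite (@partial_slice _ _ _ x i ((c / (k.+1`!)%:R) \*o (fun t => t ^+ k.+1))) => [|t].
  rewrite deriveMl; last exact: exprn_derivable.
  rewrite exp_derive /tayl -/c /= [_ *: 1]mulr1 factS natrM.
  have k0 : (k`!)%:R != 0 :> R by rewrite pnatr_eq0 -lt0n fact_gt0.
  have k1 : k.+1%:R != 0 :> R by rewrite pnatr_eq0.
  rewrite /GRing.scale /= invfM; move: (k.+1%:R : R) k1 => a a0.
  rewrite [RHS]mulrC -mulrA; congr (_ * _).
  by rewrite -mulrA mulrCA mulKf // mulrC.
by rewrite /tayl iterSr upd_upd updii /c /=; ring.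
Qed.

Lemma partial_rem_neq r N i j f : j != i -> smooth r f ->
  eqc r (partial j (rem N i f)) (rem N i (partial j f)).
Proof.
move=> ji sf x rx; have st (k : 'I_N) := @smooth_tayl r i k f sf.
rewrite /rem (partialB j sf (smooth_sum _ st) rx) (partial_sum _ j st rx).
by congr (_ - _); apply: eq_bigr => k _; exact: partial_tayl_neq.
Qed.

Lemma partial_remS r N i f : smooth r f ->
  eqc r (partial i (rem N.+1 i f)) (rem N i (partial i f)).
Proof.
move=> sf x rx; have st (k : 'I_N.+1) := @smooth_tayl r i k f sf.
rewrite /rem (partialB i sf (smooth_sum _ st) rx) (partial_sum _ i st rx).
rewrite big_ord_recl partial_tayl0 add0r; congr (_ - _).
by apply: eq_bigr => k _; exact: partial_taylS.
Qed.

Lemma partial_term_neq r N i j k f : j != i -> smooth r f ->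
  eqc r (partial j (term N i k f)) (term N i k (partial j f)).
Proof.
by rewrite /term; case: ifP => _; [exact: partial_tayl_neq|exact: partial_rem_neq].
Qed.

Lemma mvt_bound r f x i (K : R) : smooth r f -> cube r x ->
  (forall t : R, `|t| <= `|x 0 i| -> `|partial i f (upd x i t)| <= K) ->
  `|f x - f (upd x i 0)| <= K * `|x 0 i|.
Proof.
move=> sf rx fK.
have rt t : `|t| <= `|x 0 i| -> cube r (upd x i t).
  by move=> tx; apply: cube_upd => //; apply: le_lt_trans tx (rx i).
have [x0|x0] := leP 0 (x 0 i).
  have tx c : 0 <= c <= x 0 i -> `|c| <= `|x 0 i|.
    by move=> /andP[c0 cx]; rewrite !ger0_norm.
  have [c h|c h] := mvt_upd sf x0 (x := x) (i := i); first exact/rt/tx.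
  rewrite upd_id subr0 => ->; rewrite normrM.
  by apply: ler_wpM2r => //; apply/fK/tx.
have tx c : x 0 i <= c <= 0 -> `|c| <= `|x 0 i|.
  by move=> /andP[c0 cx]; rewrite !ler0_norm ?lerN2 // ltW.
have [c h|c h] := mvt_upd sf (ltW x0) (x := x) (i := i); first exact/rt/tx.
rewrite upd_id sub0r distrC => ->; rewrite normrM normrN.
by apply: ler_wpM2r => //; apply/fK/tx.
Qed.

(** By induction on the order: the derivative of a remainder of [f] is a remainder
    of the derivative of [f], and the remainder vanishes at [0]. *)
Lemma taylor_bound r N f x i (K : R) : smooth r f -> cube r x ->
  (forall t : R, `|t| <= `|x 0 i| -> `|iter N (partial i) f (upd x i t)| <= K) ->
  `|rem N i f x| <= K * `|x 0 i| ^+ N.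
Proof.
elim: N f x => [|N IH] f x sf rx fK.
  rewrite /rem big_ord0 subr0 expr0 mulr1.
  by have := fK (x 0 i); rewrite /= upd_id; apply.
have rem0 : rem N.+1 i f (upd x i 0) = 0.
  rewrite /rem big_ord_recl big1 => [|k _].
    by rewrite /tayl /= expr0 fact0 divr1 mul1r upd_upd addr0 subrr.
  by rewrite /tayl updii /= expr0n /= !mul0r.
rewrite -[rem _ _ _ _]subr0 -rem0 exprSr mulrA.
apply: (mvt_bound (smooth_rem _ _ sf) rx) => t tx.
have rt : cube r (upd x i t) by apply: cube_upd => //; apply: le_lt_trans tx (rx i).
rewrite (partial_remS _ _ sf rt).
apply: (@le_trans _ _ (K * `|t| ^+ N)).
  have := IH (partial i f) (upd x i t) (smooth_partial i sf) rt.
  rewrite updii; apply => u ut; rewrite upd_upd.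
  by have := fK u; rewrite iterSr; apply; exact: le_trans ut tx.
apply: ler_wpM2l; last by rewrite lerXn2r // nnegrE.
by apply: le_trans (fK 0 _); rewrite ?normr0.
Qed.

Lemma sum_term N i f x : \sum_(k < N.+1) term N i k f x = f x.
Proof.
rewrite big_ord_recr /= {2}/term ltnn /rem addrC.
rewrite [X in _ + X](eq_bigr (fun k : 'I_N => tayl i k f x)) ?subrK // => k _.
by rewrite /term ltn_ord.
Qed.

Lemma iter_partialB r i k f g : smooth r f -> smooth r g ->
  eqc r (iter k (partial i) (fun x => f x - g x))
        (fun x => iter k (partial i) f x - iter k (partial i) g x).
Proof.
move=> sf sg; elim: k => //= k IH; apply: eqc_trans (eqc_partial i IH) _.
by apply: partialB; exact: smooth_iter_partial.
Qed.

Lemma iter_partial_sum r (I : Type) (t : seq I) (F : I -> 'rV[R]_n -> R) i k :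
  (forall m : I, smooth r (F m)) ->
  eqc r (iter k (partial i) (fun x => \sum_(m <- t) F m x))
        (fun x => \sum_(m <- t) iter k (partial i) (F m) x).
Proof.
move=> sF; elim: k => //= k IH; apply: eqc_trans (eqc_partial i IH) _.
by apply: partial_sum => m; exact: smooth_iter_partial.
Qed.

Lemma iter_partial_tayl r i j k m f : i != j -> smooth r f ->
  eqc r (iter k (partial i) (tayl j m f)) (tayl j m (iter k (partial i) f)).
Proof.
move=> ij sf; elim: k => //= k IH; apply: eqc_trans (eqc_partial i IH) _.
by apply: partial_tayl_neq => //; exact: smooth_iter_partial.
Qed.

Lemma taylC r i j k m f : i != j -> smooth r f ->
  eqc r (tayl i k (tayl j m f)) (tayl j m (tayl i k f)).
Proof.
move=> ij sf x rx; have ji : j != i by rewrite eq_sym.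
have r0 l := cube_upd0 l rx.
rewrite /tayl -/(tayl j m f) -/(tayl i k f).
rewrite (iter_partial_tayl k m ij sf (r0 i)) (iter_partial_tayl m k ji sf (r0 j)).
rewrite /tayl !updij // updC // (iter_iter_partialC _ _ _ _ sf); last by do 2!apply: cube_upd0.
ring.
Qed.

Lemma tayl_remC r N i j k f : i != j -> smooth r f ->
  eqc r (tayl i k (rem N j f)) (rem N j (tayl i k f)).
Proof.
move=> ij sf x rx; have st (m : 'I_N) := @smooth_tayl r j m f sf.
have r0 := cube_upd0 i rx.
rewrite {1}/tayl (iter_partialB i k sf (smooth_sum _ st) r0).
rewrite (iter_partial_sum _ i k st r0) mulrBr mulr_sumr; congr (_ - _).
by apply: eq_bigr => m _; exact: (taylC k m ij sf rx).
Qed.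

Lemma tayl_termC r N i j k m f : i != j -> smooth r f ->
  eqc r (tayl i k (term N j m f)) (term N j m (tayl i k f)).
Proof. by rewrite /term; case: ifP => _; [exact: taylC|exact: tayl_remC]. Qed.

(** The expansions in the single variables are composed; the parts indexed by
    [exponents N s] sum up to [f] ([sum_taylor_part]). *)
Fixpoint taylor_part N s q f : 'rV[R]_n -> R :=
  if s is i :: s' then term N i (q i) (taylor_part N s' q f) else f.

Lemma smooth_taylor_part r N s q f : smooth r f -> smooth r (taylor_part N s q f).
Proof. by move=> sf; elim: s => //= i s; exact: smooth_term. Qed.

Lemma taylor_part_eqc r N s q f g : eqc r f g -> eqc r (taylor_part N s q f) (taylor_part N s q g).
Proof. by move=> fg; elim: s => //= i s; exact: term_eqc. Qed.

Lemma iter_partial_taylor_part r N s q f j k : j \notin s -> smooth r f ->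
  eqc r (iter k (partial j) (taylor_part N s q f)) (taylor_part N s q (iter k (partial j) f)).
Proof.
move=> js sf; elim: k => //= k IH; apply: eqc_trans (eqc_partial j IH) _ => {IH}.
have := smooth_iter_partial j k sf; move: (iter k _ _) => g sg {sf}.
elim: s js => //= i s IH; rewrite inE negb_or => /andP[ji js].
apply: eqc_trans (partial_term_neq _ _ ji (smooth_taylor_part _ _ _ sg)) _.
exact: term_eqc (IH js).
Qed.

(** Each factor of the bound comes from one variable: for a Taylor term it is
    explicit, and for a remainder it is Taylor's inequality, the expansion in
    the other variables commuting with the derivatives in this one. *)
Lemma taylor_part_bound r N s q f : 0 < r -> uniq s -> (forall i, i \in s -> (q i <= N)%N) ->
  smooth r f -> exists rho C : R, [/\ 0 < rho, rho <= r, 0 <= C &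
    forall x, cube rho x -> `|taylor_part N s q f x| <= C * \prod_(i <- s) `|x 0 i| ^+ q i].
Proof.
move=> r0; elim: s f => [|i s IH] f /=.
  move=> _ _ sf; have c0 : {for (0 : 'rV[R]_n), continuous f}.
    by apply: (smooth_continuous sf) => i; rewrite mxE normr0.
  have [|rho rho0 rhoP] := @near0_cube R n (fun x => `|f x - f 0| < 1 /\ cube r x).
    apply: filterI; last exact: cube_near0.
    by move/cvgrPdist_lt : c0 => /(_ 1 ltr01); apply: filterS => y; rewrite distrC.
  exists (Num.min rho r), (`|f 0| + 1); split.
  - by rewrite lt_min rho0.
  - by rewrite ge_min lexx orbT.
  - by rewrite addr_ge0.
  - move=> x hx; have /rhoP[/ltW h _] : cube rho x by apply: cube_le hx; rewrite ge_min lexx.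
    rewrite big_nil mulr1.
    rewrite -[f x](subrK (f 0)) addrC.
    by apply: le_trans (ler_normD _ _) _; rewrite lerD2l.
move=> /andP[ins us] qN sf.
have qN' j : j \in s -> (q j <= N)%N by move=> js; apply: qN; rewrite inE js orbT.
have updP (x : 'rV[R]_n) (t : R) : \prod_(j <- s) `|upd x i t 0 j| ^+ q j = \prod_(j <- s) `|x 0 j| ^+ q j.
  apply: eq_big_seq => j js; rewrite updij //.
  by apply: contraNneq ins => <-.
have [rho [C [rho0 rhor C0 HC]]] := IH (iter (q i) (partial i) f) us qN' (smooth_iter_partial i (q i) sf).
exists rho, C; split=> // x rhox; rewrite big_cons.
have rx : cube r x by exact: cube_le rhox.
have iterE y : cube rho y -> `|iter (q i) (partial i) (taylor_part N s q f) y| <=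
    C * \prod_(j <- s) `|y 0 j| ^+ q j.
  by move=> ry; rewrite (iter_partial_taylor_part _ _ _ ins sf (cube_le rhor ry)); exact: HC.
have P0 : 0 <= \prod_(j <- s) `|x 0 j| ^+ q j by apply: prodr_ge0 => j _; exact: exprn_ge0.
rewrite /term; case: ltnP => qiN.
  rewrite /tayl normrM normrM normrX normfV.
  have f1 : `|(q i)`!%:R|^-1 <= 1 :> R.
    rewrite invf_le1 ?normr_gt0 ?pnatr_eq0 -?lt0n ?fact_gt0 //.
    by rewrite ger0_norm // ler1n fact_gt0.
  rewrite mulrCA -mulrA; apply: ler_wpM2l; first exact: exprn_ge0.
  rewrite -[leRHS]mul1r; apply: ler_pM => //.
  by have := iterE _ (cube_upd0 i rhox); rewrite updP.
have E : q i = N by apply/eqP; rewrite eqn_leq qiN qN // inE eqxx.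
rewrite mulrCA mulrC E in iterE *.
apply: (taylor_bound (smooth_taylor_part _ _ _ sf) rx) => t tx.
have := iterE (upd x i t); rewrite updP; apply.
by apply: cube_upd => //; apply: le_lt_trans tx (rhox i).
Qed.

Definition zero_on s x : 'rV[R]_n := \row_j (if j \in s then 0 else x 0 j).

Lemma cube_zero_on r s x : cube r x -> cube r (zero_on s x).
Proof.
move=> rx j; rewrite mxE; case: ifP => // _; rewrite normr0.
exact: le_lt_trans (rx j).
Qed.

Lemma zero_on_upd s x i : zero_on s (upd x i 0) = zero_on (i :: s) x.
Proof. by apply/rowP => j; rewrite !mxE inE; case: eqP => //= _; case: ifP. Qed.

Lemma smooth_zero_on r s f : smooth r f -> smooth r (fun x => f (zero_on s x)).
Proof.
move=> sf; elim: s => [|i s IH].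
  by apply: smooth_eqc sf => x rx; congr f; apply/rowP => j; rewrite mxE.
apply: smooth_eqc (smooth_upd0 i IH) => x rx.
by rewrite zero_on_upd.
Qed.

Lemma partial_zero_on s f i x : i \notin s ->
  partial i (fun x => f (zero_on s x)) x = partial i f (zero_on s x).
Proof.
move=> ins; rewrite (@partial_slice _ _ _ x i (fun t => f (upd (zero_on s x) i t))) => [|t].
  have -> : x 0 i = zero_on s x 0 i by rewrite mxE (negPf ins).
  by rewrite -partial_upd upd_id.
congr f; apply/rowP => j; rewrite !mxE.
by case: eqP => [->|//]; rewrite (negPf ins).
Qed.

Definition mono s q x : R := \prod_(i <- s) (x 0 i ^+ q i / (q i)`!%:R).

(** Without remainders, each step only multiplies by a power of a new variable,
    which the later derivatives treat as a constant. *)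
Lemma taylor_part_explicit r N s q f : uniq s -> (forall i, i \in s -> (q i < N)%N) ->
  smooth r f ->
  eqc r (taylor_part N s q f)
    (fun x => mono s q x * iter_partial (flatten [seq nseq (q i) i | i <- s]) f (zero_on s x)).
Proof.
move=> + + sf; elim: s => [_ _|i s IH /= /andP[ins us] qN].
  move=> x rx; rewrite /mono big_nil mul1r /=; congr f.
  by apply/rowP => j; rewrite mxE.
have qN' j : j \in s -> (q j < N)%N by move=> js; apply: qN; rewrite inE js orbT.
rewrite /term qN ?inE ?eqxx //.
apply: eqc_trans (tayl_eqc i (q i) (IH us qN')) _ => {IH}.
set D := iter_partial _ f.
have sD : smooth r D by exact: smooth_iter_partial_seq.
have Mi (x : 'rV[R]_n) (t : R) : mono s q (upd x i t) = mono s q x.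
  by apply: eq_big_seq => j js; rewrite updij //; apply: contraNneq ins => <-.
have iE k : eqc r (iter k (partial i) (fun x => mono s q x * D (zero_on s x)))
    (fun x => mono s q x * iter k (partial i) D (zero_on s x)).
  elim: k => //= k IH; apply: eqc_trans (eqc_partial i IH) _.
  have sk := smooth_zero_on s (smooth_iter_partial i k sD).
  apply: eqc_trans (partial_constM Mi sk) _ => x _.
  by rewrite partial_zero_on.
move=> x rx; rewrite /tayl iE; last exact: cube_upd0.
rewrite Mi zero_on_upd {2}/mono big_cons -/(mono s q x) mulrA; congr (_ * _).
suff -> : iter_partial (nseq (q i) i ++ flatten [seq nseq (q j) j | j <- s]) f =
  iter (q i) (partial i) D by [].
by rewrite /D /iter_partial foldr_cat; elim: (q i) => //= k ->.
Qed.

Lemma tayl_taylor_partC r N s q i k f : i \notin s -> smooth r f ->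
  eqc r (tayl i k (taylor_part N s q f)) (taylor_part N s q (tayl i k f)).
Proof.
move=> + sf; elim: s => //= j s IH; rewrite inE negb_or => /andP[ij ins].
apply: eqc_trans (tayl_termC _ _ _ ij (smooth_taylor_part _ _ _ sf)) _.
exact: term_eqc (IH ins).
Qed.

(** Taylor terms commute with the operators of the other variables, so they can
    all be moved inside the remainders. *)
Lemma taylor_part_split r N s q f : uniq s -> smooth r f ->
  eqc r (taylor_part N s q f)
    (taylor_part N [seq i <- s | ~~ (q i < N)%N] q (taylor_part N [seq i <- s | (q i < N)%N] q f)).
Proof.
move=> + sf; elim: s => //= i s IH /andP[ins us].
apply: eqc_trans (term_eqc N i (q i) (IH us)) _ => {IH}.
case: ltnP => //= qi; rewrite /term qi.
apply: eqc_trans (tayl_taylor_partC _ _ _ _ (smooth_taylor_part _ _ _ sf)) _ => //.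
by rewrite mem_filter (negPf ins) andbF.
Qed.

Lemma taylor_part0 N s q x : taylor_part N s q (fun=> 0) x = 0.
Proof.
have t0 i k : tayl i k (fun=> 0) = (fun=> 0).
  apply/funext => y; rewrite /tayl.
  have -> : iter k (partial i) (fun=> 0) = (fun=> 0) :> ('rV[R]_n -> R).
    by elim: k => //= k ->; apply/funext => z; rewrite partial_cst.
  by rewrite mulr0.
suff -> : taylor_part N s q (fun=> 0) = (fun=> 0) by [].
elim: s => //= i s ->; rewrite /term t0; case: ifP => // _.
apply/funext => y; rewrite /rem big1 ?subr0 // => k _; by rewrite t0.
Qed.

(** It suffices to annihilate the coefficient function of a part, before any
    remainder of it is formed. *)
Lemma taylor_part_vanish r N s q f : uniq s -> smooth r f ->
  eqc r (taylor_part N [seq i <- s | (q i < N)%N] q f) (fun=> 0) ->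
  eqc r (taylor_part N s q f) (fun=> 0).
Proof.
move=> us sf h; apply: eqc_trans (taylor_part_split _ _ us sf) _.
apply: eqc_trans (taylor_part_eqc _ _ _ h) _ => x _; exact: taylor_part0.
Qed.

Definition set_exp q i k : {ffun 'I_n -> nat} := [ffun j => if j == i then k else q j].

Fixpoint exponents N s : seq {ffun 'I_n -> nat} :=
  if s is i :: s' then [seq set_exp q i k | q <- exponents N s', k <- iota 0 N.+1]
  else [:: [ffun=> 0%N]].

Lemma exponentsP N s q : uniq s ->
  reflect ((forall i, i \in s -> (q i <= N)%N) /\ (forall i, i \notin s -> q i = 0%N))
          (q \in exponents N s).
Proof.
elim: s q => [|i s IH] q.
  move=> _; rewrite inE; apply: (iffP eqP) => [->|[_ h]].
    by split=> // i _; rewrite ffunE.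
  by apply/ffunP => i; rewrite ffunE h.
rewrite cons_uniq => /andP[ins us]; apply: (iffP allpairsP) => [[[p k] [/(IH p us)[h1 h2] kN ->]]|[h1 h2]].
  rewrite [(p, k).2]/= mem_iota add0n ltnS in kN *; split => j; rewrite ffunE inE.
    by case: eqP => //= _; exact: h1.
  by rewrite negb_or => /andP[/negPf-> /h2].
exists (set_exp q i 0, q i); split.
- apply/(IH (set_exp q i 0) us); split=> j js; rewrite ffunE; case: eqP => // ji.
    by apply: h1; rewrite inE js orbT.
  by apply: h2; rewrite inE negb_or js andbT; apply/eqP.
- by rewrite [(_, _).2]/= mem_iota add0n ltnS h1 // inE eqxx.
- by apply/ffunP => j; rewrite !ffunE; case: eqP => [->|].
Qed.

Lemma exponents_uniq N s : uniq s -> uniq (exponents N s).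
Proof.
elim: s => // i s IH; rewrite cons_uniq => /andP[ins us]; apply: allpairs_uniq; [exact: IH|exact: iota_uniq|].
move=> z z' /allpairsP[[a b] [/(exponentsP _ _ us)[_ hp] _ ->]].
move=> /allpairsP[[a' b'] [/(exponentsP _ _ us)[_ hp'] _ ->]] /ffunP E.
rewrite [(a, b).1]/= in hp; rewrite [(a', b').1]/= in hp'.
have := E i; rewrite !ffunE eqxx => ->; congr (_, _).
apply/ffunP => j; have := E j; rewrite !ffunE; case: eqP => // -> _.
by rewrite hp // hp'.
Qed.

Lemma sum_taylor_part N s f x : uniq s -> \sum_(q <- exponents N s) taylor_part N s q f x = f x.
Proof.
elim: s => [_|i s IH]; first by rewrite big_seq1.
rewrite cons_uniq => /andP[ins us]; rewrite big_allpairs_dep -[RHS](IH us); apply: eq_big_seq => q _.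
have setE k : taylor_part N s (set_exp q i k) f = taylor_part N s q f.
  elim: (s) (ins) => //= j t IHt; rewrite inE negb_or => /andP[ij /IHt ->].
  by rewrite ffunE eq_sym (negPf ij).
rewrite -[RHS](sum_term N i) -(big_mkord xpredT (fun k => term N i k (taylor_part N s q f) x)).
rewrite /index_iota subn0; apply: eq_bigr => k _.
by rewrite -(setE k) /= ffunE eqxx.
Qed.

End Taylor.

(** * Asymptotics along weighted curves *)

Section Powers.
Context {R : realType}.

Lemma powR_sum_small (I : eqType) (s : seq I) (a e : I -> R) (eps : R) : 0 < eps ->
  (forall i, i \in s -> 0 < a i) ->
  \forall t \near (0 : R)^'+, `|\sum_(i <- s) t `^ a i * e i| < eps.
Proof.
elim: s eps => [|i s IH] eps eps0 a0.
  by apply: nearW => t; rewrite big_nil normr0.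
have eps2 : 0 < eps / 2 by rewrite divr_gt0.
have h := IH _ eps2 (fun j js => a0 j (@mem_behead _ (i :: s) j js)).
have ai : 0 < a i by apply: a0; rewrite inE eqxx.
have d0 : 0 < eps / 2 / (`|e i| + 1) by rewrite divr_gt0 // ltr_wpDl.
near=> t; rewrite big_cons.
apply: le_lt_trans (ler_normD _ _) _; rewrite [ltRHS]splitr; apply: ltrD; last by near: t.
have : t `^ a i < eps / 2 / (`|e i| + 1).
  near: t; move/cvgrPdist_lt : (powR_cvg0 ai) => /(_ _ d0).
  by apply: filterS => t; rewrite sub0r normrN ger0_norm // powR_ge0.
rewrite ltr_pdivlMr ?ltr_wpDl // => lt1; rewrite normrM ger0_norm ?powR_ge0 //.
apply: le_lt_trans lt1; apply: ler_wpM2l; first exact: powR_ge0.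
by rewrite lerDl.
Unshelve. all: by end_near. Qed.

Lemma exists_min_seq (I : eqType) (s : seq I) (mu : I -> R) i0 : i0 \in s ->
  exists2 i, i \in s & forall j, j \in s -> mu i <= mu j.
Proof.
elim: s i0 => // i s IH i0; case: s IH => [|k s] IH i0s.
  by exists i => [|j]; rewrite ?inE ?eqxx // => /eqP->.
have [j js hj] := IH k (mem_head _ _).
have [ij|ji] := leP (mu i) (mu j).
  exists i => [|k']; rewrite inE ?eqxx // => /predU1P[->//|/hj]; exact: le_trans.
exists j => [|k']; rewrite inE ?js ?orbT // => /predU1P[->|/hj//]; exact: ltW.
Qed.

(** In a sum of distinct powers of [t], the least exponent with a nonzero
    coefficient governs the behaviour at [0+]. *)
Lemma distinct_powers (I : eqType) (s : seq I) (mu e : I -> R) (l K : R) : uniq s ->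
  {in s &, injective mu} ->
  (\forall t \near (0 : R)^'+, `|\sum_(i <- s) t `^ mu i * e i| <= K * t `^ l) ->
  forall i, i \in s -> mu i < l -> e i = 0.
Proof.
move=> us imu hK i ins il; apply: contrapT => /eqP ei.
pose s0 := [seq j <- s | e j != 0].
have is0 : i \in s0 by rewrite mem_filter ei.
have [i0 i0s hi0] := exists_min_seq mu is0.
have i0l : mu i0 < l by apply: le_lt_trans (hi0 i is0) il.
move: i0s; rewrite mem_filter => /andP[ei0 i0s].
pose s' := [seq j <- s | (j != i0) && (e j != 0)].
have s'P j : j \in s' -> 0 < mu j - mu i0.
  rewrite mem_filter => /andP[/andP[ji0 ej] js]; rewrite subr_gt0 lt_neqAle hi0 ?andbT.
    by apply: contra ji0 => /eqP /imu ->.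
  by rewrite mem_filter ej.
have e2 : 0 < `|e i0| / 2 by rewrite divr_gt0 ?normr_gt0.
have h1 := powR_sum_small e e2 s'P.
have h2 := @powR_sum_small _ [:: tt] (fun=> l - mu i0) (fun=> K) _ e2.
have {}h2 := h2 (fun _ _ => ltac:(by rewrite subr_gt0)).
have [t [[t0 ht1] [ht2 ht3]]] :=
  filter_ex (filterI (filterI (nbhs_right_gt (0 : R)) h1) (filterI h2 hK)).
have p0 : 0 < t `^ mu i0 by exact: powR_gt0.
have powE a : t `^ a = t `^ mu i0 * t `^ (a - mu i0).
  by rewrite -powRD ?subrKC // (gt_eqF t0) implybT.
have E : \sum_(j <- s) t `^ mu j * e j =
    t `^ mu i0 * (e i0 + \sum_(j <- s') t `^ (mu j - mu i0) * e j).
  rewrite (bigD1_seq i0) //= mulrDr; congr (_ + _).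
  rewrite big_filter mulr_sumr [LHS](bigID (fun j => e j != 0)) /= addrC big1 ?add0r.
    by apply: eq_bigr => j _; rewrite mulrA -powE.
  by move=> j /andP[_ /negPn/eqP->]; rewrite mulr0.
move: ht3 ht2; rewrite E (powE l) normrM gtr0_norm // mulrCA ler_pM2l // big_seq1.
move=> ht3 ht2; have := ler_norm (t `^ (l - mu i0) * K).
have := ler_normB (e i0 + \sum_(j <- s') t `^ (mu j - mu i0) * e j)
                  (\sum_(j <- s') t `^ (mu j - mu i0) * e j).
rewrite addrK mulrC in ht3 *; lra.
Qed.

Lemma horner_near_gt0 (P : {poly R}) : 0 < P.[0] -> \forall s \near (0 : R)^'+, 0 < P.[s].
Proof.
move=> P0; apply: cvg_within.
exact: (cvgr_gt _ (@continuous_horner R P 0)).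
Qed.

Lemma horner_near_neq0 (P : {poly R}) : P != 0 -> \forall s \near (0 : R)^'+, P.[s] != 0.
Proof.
have [m [Q /=]] := multiplicity_XsubC P 0; move=> + PQ P0.
rewrite P0 /= => Q0; rewrite subr0 in PQ.
have Q2 : 0 < (Q ^+ 2).[0] by rewrite horner_exp exprn_even_gt0.
near=> s.
have s0 : 0 < s by near: s; exact: nbhs_right_gt.
have : 0 < (Q ^+ 2).[s] by near: s; exact: horner_near_gt0.
rewrite horner_exp exprn_even_gt0 //= => Qs.
by rewrite PQ hornerM hornerXn mulf_neq0 // expf_neq0 // gt_eqF.
Unshelve. all: by end_near. Qed.

Lemma cvg_powR_bounded (phi : R -> R) (l : R) : cvg (phi t / t `^ l @[t --> 0^'+]) ->
  exists K, \forall t \near (0 : R)^'+, `|phi t| <= K * t `^ l.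
Proof.
move=> /cvg_ex[L /cvgrPdist_lt/(_ 1 ltr01) hL]; exists (`|L| + 1); near=> t.
have t0 : 0 < t by near: t; exact: nbhs_right_gt.
have hLt : `|L - phi t / t `^ l| < 1 by near: t.
have tl : 0 < t `^ l by exact: powR_gt0.
have -> : phi t = phi t / t `^ l * t `^ l by rewrite mulfVK // gt_eqF.
rewrite normrM (gtr0_norm tl); apply: ler_wpM2r; first exact: ltW.
have := ler_normB L (L - phi t / t `^ l).
rewrite opprB addrCA subrr addr0; lra.
Unshelve. all: by end_near. Qed.

End Powers.

Section Weights.
Context {R : realType} {n : nat}.
Implicit Types (x y w : 'rV[R]_n) (f : 'rV[R]_n -> R) (i j : 'I_n) (r : R).
Implicit Types (N k m : nat) (q : {ffun 'I_n -> nat}) (s : seq 'I_n).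

Lemma powR_dot w q (t : R) : 0 < t ->
  \prod_i (t `^ w 0 i) ^+ q i = t `^ dot w (int_point q).
Proof.
move=> t0; have tD : {morph (powR t) : a b / a + b >-> a * b}.
  by move=> a b; rewrite powRD // (gt_eqF t0) implybT.
rewrite /dot (big_morph _ tD (powRr0 t)); apply: eq_bigr => i _.
by rewrite mxE powRrM powR_mulrn ?powR_ge0.
Qed.

Lemma monomial_scale w q (t : R) x : 0 < t ->
  monomial q (weighted_scale w t x) = t `^ dot w (int_point q) * monomial q x.
Proof.
move=> t0; rewrite -powR_dot // -big_split; apply: eq_bigr => i _.
by rewrite mxE exprMn.
Qed.

Lemma cube_scale r w (t : R) x : (forall i, 0 <= w 0 i) -> 0 < t <= 1 -> cube r x ->
  cube r (weighted_scale w t x).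
Proof.
move=> w0 /andP[t0 t1] rx i; rewrite mxE normrM ger0_norm ?powR_ge0 //.
apply: le_lt_trans (rx i); rewrite -[leRHS]mul1r; apply: ler_wpM2r => //.
by rewrite -(powRr0 t); apply: ger_powR; rewrite ?t0.
Qed.

(** The distinct powers of [s] turn a coincidence between the values of the weight
    at two exponents into a zero of a nonzero polynomial in [s]. *)
Definition perturb (I : pred 'I_n) w (s : R) : 'rV[R]_n :=
  \row_i (if I i then w 0 i + s ^+ i.+1 else 0).

Definition perturb_poly (I : pred 'I_n) w (d : 'rV[R]_n) : {poly R} :=
  \sum_(i | I i) d 0 i *: ((w 0 i)%:P + 'X^(i.+1)).

Lemma horner_perturb (I : pred 'I_n) w d (s : R) : (perturb_poly I w d).[s] = dot (perturb I w s) d.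
Proof.
rewrite /dot /perturb_poly horner_sum big_mkcond; apply: eq_bigr => i _.
rewrite !mxE; case: ifP => _; rewrite ?mul0r //.
by rewrite hornerZ hornerD hornerC hornerXn mulrC.
Qed.

Lemma perturb_poly_neq0 (I : pred 'I_n) w (d : 'rV[R]_n) i : I i -> d 0 i != 0 -> perturb_poly I w d != 0.
Proof.
move=> Ii di; apply: contra di => /eqP/(congr1 (fun P : {poly R} => P`_i.+1)).
rewrite coef0 coef_sum (bigD1 i) //= coefZ coefD coefC coefXn eqxx add0r mulr1.
rewrite big1 ?addr0 => [->//|j /andP[_ ji]].
rewrite coefZ coefD coefC coefXn eqSS (_ : (i == j :> nat) = false) /= ?addr0 ?mulr0 //.
by apply/negbTE; rewrite eq_sym.
Qed.

(** Finitely many nonzero polynomials have no small positive zeros, and strict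
    inequalities at [s = 0] persist. *)
Lemma generic_weight (I : pred 'I_n) w (Q : seq {ffun 'I_n -> nat}) (T : finType)
    (D : {set T}) (d : T -> 'rV[R]_n) :
  (forall i, 0 < w 0 i) ->
  (forall q q', q \in Q -> q' \in Q -> (forall i, I i -> q i = q' i) -> q = q') ->
  (forall t, t \in D -> 0 < dot (perturb I w 0) (d t)) ->
  exists w', [/\ forall i, I i -> w 0 i <= w' 0 i <= w 0 i + 1,
    forall i, ~~ I i -> w' 0 i = 0,
    {in Q &, injective (fun q => dot w' (int_point q))} &
    forall t, t \in D -> 0 < dot w' (d t)].
Proof.
move=> w0 QI dw.
pose L q q' := perturb_poly I w (int_point q - int_point q').
pose P : {poly R} := \prod_(q <- Q) \prod_(q' <- Q | q' != q) L q q'.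
have P0 : P != 0.
  rewrite /P big_seq_cond prodf_seq_neq0; apply/allP => q qQ; apply/implyP => _.
  rewrite big_seq_cond prodf_seq_neq0; apply/allP => q' q'Q; apply/implyP => /andP[_ qq'].
  have [i /andP[Ii qi]] : exists i, I i && (q i != q' i).
    apply/existsP; apply: contraNT qq'; rewrite negb_exists => /forallP h.
    apply/eqP/QI => // i Ii; have := h i; rewrite Ii /= negbK => /eqP.
    by move=> ->.
  apply: (perturb_poly_neq0 _ Ii); rewrite !mxE subr_eq0 eqr_nat //.
have h1 := horner_near_neq0 P0.
have h2 : \forall s \near (0 : R)^'+, forall t, t \in D -> 0 < dot (perturb I w s) (d t).
  apply: filter_forall => t; have [tD|_] := boolP (t \in D); last exact: nearW.
  have := @horner_near_gt0 R (perturb_poly I w (d t)); rewrite horner_perturb.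
  by move=> /(_ (dw t tD)); apply: filterS => s; rewrite horner_perturb.
have [s [[s0 s1] [hs1 hs2]]] := filter_ex
  (filterI (filterI (nbhs_right_gt (0 : R)) (nbhs_right_le (@ltr01 R))) (filterI h1 h2)).
exists (perturb I w s); split=> [i Ii|i /negPf nI|q q' qQ q'Q|//].
- by rewrite mxE Ii lerDl lerD2l exprn_ge0 ?exprn_ile1 // ltW.
- by rewrite mxE nI.
- move=> E; apply: contrapT => /eqP qq'; move: hs1; rewrite /P horner_prod.
  rewrite prodf_seq_neq0 => /allP/(_ q qQ)/=.
  rewrite horner_prod prodf_seq_neq0 => /allP/(_ q' q'Q)/=.
  by rewrite eq_sym qq' horner_perturb dotBr E subrr eqxx.
Qed.

Lemma taylor_part_bound_all r N s f (Q : seq {ffun 'I_n -> nat}) : 0 < r -> uniq s ->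
  (forall q i, q \in Q -> i \in s -> (q i <= N)%N) -> smooth r f ->
  exists rho C : R, [/\ 0 < rho, rho <= r, 0 <= C &
    forall q x, q \in Q -> cube rho x ->
      `|taylor_part N s q f x| <= C * \prod_(i <- s) `|x 0 i| ^+ q i].
Proof.
move=> r0 us + sf; elim: Q => [_|q Q IH QN]; first by exists r, 0; split.
have [p i pQ|rho1 [C1 [rho10 rho1r C10 H1]]] := IH.
  by apply: QN; rewrite inE pQ orbT.
have [i ins|rho2 [C2 [rho20 rho2r C20 H2]]] := @taylor_part_bound R n r N s q f r0 us _ sf.
  by apply: QN => //; rewrite inE eqxx.
exists (Num.min rho1 rho2), (C1 + C2); split.
- by rewrite lt_min rho10.
- by rewrite ge_min rho1r.
- by rewrite addr_ge0.
- move=> p x + hx; have P0 : 0 <= \prod_(i <- s) `|x 0 i| ^+ p i.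
    by apply: prodr_ge0 => i _; exact: exprn_ge0.
  have x1 : cube rho1 x by apply: cube_le hx; rewrite ge_min lexx.
  have x2 : cube rho2 x by apply: cube_le hx; rewrite ge_min lexx orbT.
  rewrite inE => /predU1P[Ep|pQ]; rewrite mulrDl.
    by rewrite -[leLHS]add0r; apply: lerD; [exact: mulr_ge0|rewrite Ep; exact: H2].
  by rewrite -[leLHS]addr0; apply: lerD; [exact: H1|exact: mulr_ge0].
Qed.

(** Where the expansion of [f] in the variables [I = {i | q i < N}] has a
    coefficient off the Newton polyhedron, the KN-condition for a generic weight
    positive exactly on [I] makes this coefficient vanish: along the weighted
    curve it contributes a power of [t] that is smaller than allowed and differs
    from all other powers. The auxiliary order [N'] makes the remainders of the
    expansion negligible along that curve. *)
Lemma KN_taylor_part_vanish r f (T : finType) (e : T -> {ffun 'I_n -> nat}) (D : {set T}) N q :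
  0 < r -> smooth r f -> KN_condition f ->
  newton_polyhedron f = hull_up (fun t => int_point (e t)) D -> D != finset.set0 ->
  (forall t i, (e t i <= N)%N) -> (forall i, (q i <= N)%N) ->
  ~ newton_polyhedron f (int_point q) ->
  exists2 rho : R, 0 < rho <= r &
    eqc rho (taylor_part N [seq i <- enum 'I_n | (q i < N)%N] q f) (fun=> 0).
Proof.
move=> r0 sf KN PE D0 eN qN nP.
pose I : pred 'I_n := fun i => (q i < N)%N; set sI := [seq i <- _ | _].
have sIP i : (i \in sI) = I i by rewrite mem_filter mem_enum andbT.
have us : uniq sI by rewrite filter_uniq ?enum_uniq.
(* forgetting the coordinates off [I] keeps the point off the polyhedron, since
   there [q i = N] is at least the coordinate of every generator *)
pose cut (p : {ffun 'I_n -> nat}) : 'rV[R]_n := \row_i (if I i then (p i)%:R else 0).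
have [w0 [w0p hw0]] : exists w, (forall i, 0 < w 0 i) /\
    forall t, t \in D -> dot w (cut q) < dot w (cut (e t)).
  apply: hull_up_sep => -[lam [l0 lD l1 lx]]; apply: nP; rewrite PE.
  exists lam; split=> // i; rewrite mxE.
  have := lx i; rewrite !mxE; case: ifPn => [Ii|nI _].
    by under eq_bigr do rewrite mxE Ii; under [X in _ -> X <= _]eq_bigr do rewrite mxE.
  have -> : q i = N by apply/eqP; rewrite eqn_leq qN leqNgt.
  have <- : \sum_t lam t * N%:R = N%:R by rewrite -mulr_suml l1 mul1r.
  apply: ler_sum => t _; by rewrite mxE ler_wpM2l // ler_nat.
have [t0 t0D] := set0Pn _ D0.
(* [bound] dominates the minimum of every weight that differs from [w0] by at most
   1, so that [N'] can be fixed before the generic weight *)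
pose bound := \sum_i (w0 0 i + 1) * (e t0 i)%:R.
have bound0 : 0 <= bound.
  by apply: sumr_ge0 => i _; rewrite mulr_ge0 // addr_ge0 // ltW.
pose w1 := \sum_i (w0 0 i)^-1.
have w1P i : 1 <= w0 0 i * w1.
  rewrite /w1 (bigD1 i) //= mulrDr mulfV ?gt_eqF // lerDl mulr_ge0 ?(ltW (w0p i)) //.
  by apply: sumr_ge0 => j _; rewrite invr_ge0 ltW.
pose N' := maxn N (Num.truncn (bound * w1)).+1.
have NN' : (N <= N')%N by rewrite leq_maxl.
have N'bound i : bound <= w0 0 i * N'%:R.
  have w1p : 0 <= w1 by apply: sumr_ge0 => j _; rewrite invr_ge0 ltW.
  have h : bound * w1 <= N'%:R.
    apply: (@le_trans _ _ (Num.truncn (bound * w1)).+1%:R).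
      by apply/ltW/Num.Theory.truncnS_gt.
    by rewrite ler_nat leq_maxr.
  apply: (@le_trans _ _ (w0 0 i * (bound * w1))); last by rewrite ler_pM2l.
  by rewrite mulrCA -[leLHS]mulr1 ler_wpM2l.
have pert0 p : dot (perturb I w0 0) (int_point p) = dot w0 (cut p).
  apply: eq_bigr => i _; rewrite !mxE.
  by case: ifP => _; rewrite ?mul0r ?mulr0 // expr0n /= addr0.
have [w [w01 w0I winj wD]] := @generic_weight I w0 (exponents N' sI) T D
    (fun t => int_point (e t) - int_point q) w0p
    ltac:(move=> p p' /(exponentsP _ _ us)[_ hp] /(exponentsP _ _ us)[_ hp'] h;
          apply/ffunP => i; case: (boolP (I i)) => [/h//|nI];
          by rewrite hp ?hp' // sIP)
    ltac:(by move=> t tD; rewrite dotBr !pert0 subr_gt0; exact: hw0).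
have wI i : I i -> 0 < w 0 i by move=> /w01/andP[+ _]; exact: lt_le_trans.
have wge0 i : 0 <= w 0 i.
  by have [/wI/ltW//|/w0I->] := boolP (I i).
have [tm tmD tmin] := exists_min_dot (fun t => int_point (e t)) w D0.
set l := dot w (int_point (e tm)) in tmin.
have ql : dot w (int_point q) < l by rewrite -subr_gt0 -dotBr; exact: wD.
have lN' i : I i -> l <= w 0 i * N'%:R.
  move=> Ii; apply: (@le_trans _ _ (w0 0 i * N'%:R)); last first.
    by apply: ler_wpM2r => //; case/andP: (w01 i Ii).
  apply: le_trans (N'bound i); apply: le_trans (tmin t0 t0D) _.
  apply: ler_sum => j _; rewrite mxE; apply: ler_wpM2r => //.
  have [/w01/andP[]//|/w0I->] := boolP (I j).
  by rewrite addr_ge0 // ltW.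
have face : defines_face (newton_polyhedron f) w l (face_of (newton_polyhedron f) w l).
  rewrite PE; split=> //; first exact: hull_up_valid.
  by exists (int_point (e tm)); split => //; exact: hull_up_gen.
have [rho1 rho10 KN1] := near0_cube (KN _ _ _ face).
have [p i /(exponentsP _ _ us)[hp _]|rho2 [C [rho20 rho2r C0 HC]]] :=
  @taylor_part_bound_all r N' sI f (exponents N' sI) r0 us _ sf; first exact: hp.
pose rho := Num.min (Num.min rho1 rho2) 1.
have rhoP x : cube rho x -> [/\ cube rho1 x, cube rho2 x & cube 1 x].
  by move=> h; split; apply: cube_le h; rewrite !ge_min lexx ?orbT.
exists rho.
  by rewrite !lt_min rho10 rho20 ltr01 /= !ge_min rho2r orbT.
move=> x /rhoP[x1 x2 x3].
pose qI : {ffun 'I_n -> nat} := [ffun i => if I i then q i else 0%N].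
have qIQ : qI \in exponents N' sI.
  apply/exponentsP => //; split=> i; rewrite sIP ffunE; last by move=> /negPf->.
  by move=> ->; exact: leq_trans (qN i) NN'.
(* without remainders the order of the expansion does not matter *)
have -> : taylor_part N sI q f = taylor_part N' sI qI f.
  have : all I sI by apply/allP => i; rewrite sIP.
  elim: (sI) => //= i s IH /andP[Ii /IH ->].
  have Iq : (q i < N)%N := Ii.
  by rewrite /term ffunE Ii Iq (leq_trans Iq NN').
have qIl : dot w (int_point qI) < l.
  rewrite (_ : dot w (int_point qI) = dot w (int_point q)) //.
  by apply: eq_bigr => i _; rewrite !mxE ffunE; case: ifPn => // /w0I->; rewrite !mul0r.
pose good (p : {ffun 'I_n -> nat}) := all (fun i => p i < N')%N sI.
have [K hK] : exists K, \forall t \near (0 : R)^'+,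
    `|f (weighted_scale w t x)| <= K * t `^ l.
  exact: cvg_powR_bounded (KN1 x x1).
(* along the curve the remainders are of order [t^l], like [f] itself *)
apply: (@distinct_powers R _ [seq p <- exponents N' sI | good p]
  (fun p => dot w (int_point p)) (fun p => taylor_part N' sI p f x) l
  (K + \sum_(p <- exponents N' sI | ~~ good p) C)) => //.
- by rewrite filter_uniq // exponents_uniq.
- by move=> p p'; rewrite !mem_filter => /andP[_ h] /andP[_ h']; exact: winj.
- near=> t.
  have t0' : 0 < t by near: t; exact: nbhs_right_gt.
  have t1 : t <= 1 by near: t; exact: nbhs_right_le.
  have wt : 0 < t <= 1 by rewrite t0'.
  have xt2 := cube_scale wge0 wt x2; have xt3 := cube_scale wge0 wt x3.
  have powI (p : {ffun 'I_n -> nat}) :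
      t `^ dot w (int_point p) = \prod_(i <- sI) (t `^ w 0 i) ^+ p i.
    rewrite -powR_dot // (bigID I) /= [X in _ * X]big1 ?mulr1 => [|i /w0I->]; last first.
      by rewrite powRr0 expr1n.
    by rewrite /sI big_filter big_enum_cond.
  have scaleP (p : {ffun 'I_n -> nat}) : \prod_(i <- sI) `|weighted_scale w t x 0 i| ^+ p i =
      t `^ dot w (int_point p) * \prod_(i <- sI) `|x 0 i| ^+ p i.
    rewrite powI -big_split; apply: eq_bigr => i _.
    by rewrite mxE normrM exprMn ger0_norm ?powR_ge0.
  have sum : \sum_(p <- [seq p <- exponents N' sI | good p])
      t `^ dot w (int_point p) * taylor_part N' sI p f x =
      f (weighted_scale w t x) - \sum_(p <- exponents N' sI | ~~ good p)
         taylor_part N' sI p f (weighted_scale w t x).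
    rewrite -(sum_taylor_part N' f (weighted_scale w t x) us) [in RHS](bigID good) /= addrK.
    rewrite big_filter [LHS]big_seq_cond [RHS]big_seq_cond; apply: eq_bigr => p /andP[pQ /allP gp].
    have h := taylor_part_explicit us gp sf.
    rewrite (h _ (cube_le rho2r x2)) (h _ (cube_le rho2r xt2)).
    rewrite mulrA; congr (_ * iter_partial _ f _); last first.
      apply/rowP => i; rewrite !mxE sIP; case: ifPn => // /w0I->.
      by rewrite powRr0 mul1r.
    rewrite /mono powI -big_split; apply: eq_bigr => i _.
    by rewrite /= mxE exprMn mulrA.
  rewrite {}sum mulrDl; apply: le_trans (ler_normB _ _) _; apply: lerD; first by near: t.
  apply: le_trans (ler_norm_sum _ _ _) _; rewrite mulr_suml.
  rewrite big_seq_cond [leRHS]big_seq_cond; apply: ler_sum => p /andP[pQ].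
  rewrite -has_predC => /hasP[i ins /= piN].
  apply: le_trans (HC p _ pQ xt2) _; rewrite scaleP.
  apply: ler_wpM2l => //; rewrite -[leRHS]mulr1; apply: ler_pM.
  + exact: powR_ge0.
  + by apply: prodr_ge0 => j _; exact: exprn_ge0.
  + apply: ger_powR => //; apply: le_trans (lN' i _) _; first by rewrite -sIP.
    have [hp _] := exponentsP _ _ us pQ.
    have <- : p i = N' by apply/eqP; rewrite eqn_leq hp // leqNgt.
    rewrite /dot (bigD1 i) //= mxE lerDl; apply: sumr_ge0 => j _.
    by rewrite mxE mulr_ge0.
  + by apply: prodr_ile1 => j; rewrite exprn_ge0 // exprn_ile1 // ltW.
- rewrite mem_filter qIQ andbT; apply/allP => i; rewrite sIP ffunE => Ii.
  by rewrite Ii; exact: leq_trans Ii NN'.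
Unshelve. all: by end_near. Qed.

End Weights.

(** * The Newton polyhedron controls the function *)

Section Newton.
Context {R : realType} {n : nat}.
Implicit Types (x y w : 'rV[R]_n) (i j : 'I_n) (q : {ffun 'I_n -> nat}).

Lemma taylor_coeff_newton (f : 'rV[R]_n -> R) q :
  taylor_coeff f q != 0 -> newton_polyhedron f (int_point q).
Proof.
move=> cq; apply: sub_gen_smallest; exists q => //; exists 0; last by rewrite addr0.
by move=> i; rewrite mxE.
Qed.

Lemma norm_monomial q x : `|monomial q x| = \prod_i `|x 0 i| ^+ q i.
Proof. by rewrite normr_prod; apply: eq_bigr => i _; rewrite normrX. Qed.

Variables (f : 'rV[R]_n -> R) (r : R) (T : finType) (e : T -> {ffun 'I_n -> nat}).
Variables (D : {set T}) (N : nat).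
Hypotheses (r0 : 0 < r) (sf : smooth r f) (KN : KN_condition f).
Hypothesis PE : newton_polyhedron f = hull_up (fun t => int_point (e t)) D.
Hypotheses (D0 : D != finset.set0) (eN : forall t i, (e t i < N)%N).

Let P := newton_polyhedron f.
Let Q := exponents N (enum 'I_n).
Let low q := [forall i, (q i < N)%N].
Let inP q := `[< P (int_point q) >].
Let c q := taylor_coeff f q.

Let QP q : reflect (forall i, (q i <= N)%N) (q \in Q).
Proof.
apply: (iffP (exponentsP _ _ (enum_uniq 'I_n))) => [[h _] i|h].
  by apply: h; rewrite mem_enum.
by split=> i //; rewrite mem_enum.
Qed.

Let eQ t : e t \in Q.
Proof. by apply/QP => i; exact/ltnW/eN. Qed.

Let eP t : t \in D -> P (int_point (e t)).
Proof. by move=> tD; rewrite /P PE; exact: hull_up_gen. Qed.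

Lemma everywhere_continuous (h : 'rV[R]_n -> R) : (forall s, smooth s h) -> continuous h.
Proof.
move=> sh x; apply: (smooth_continuous (sh (\sum_i `|x 0 i| + 1))) => i.
by rewrite (bigD1 i) //= -addrA ltrDl ltr_wpDl // sumr_ge0.
Qed.

Lemma taylor_part_low q : low q ->
  eqc r (taylor_part N (enum 'I_n) q f) (fun x => c q * monomial q x).
Proof.
move=> /forallP ql x rx.
rewrite (taylor_part_explicit (enum_uniq _) (fun i _ => ql i) sf rx).
have -> : zero_on (enum 'I_n) x = 0 by apply/rowP => i; rewrite !mxE mem_enum.
rewrite /c /taylor_coeff /deriv_multi mulrC -mulrA; congr (_ * _).
rewrite /mono big_enum natr_prod big_split /= prodfV mulrC.
by rewrite /monomial.
Qed.

Lemma vanishing_parts (Q' : seq {ffun 'I_n -> nat}) : {subset Q' <= Q} ->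
  exists2 rho : R, 0 < rho <= r & forall q, q \in Q' -> ~~ inP q ->
    eqc rho (taylor_part N (enum 'I_n) q f) (fun=> 0).
Proof.
elim: Q' => [_|q Q' IH sub]; first by exists r; rewrite ?r0 /=.
have [p pQ|rho /andP[rho0 rhor] H] := IH; first by apply: sub; rewrite inE pQ orbT.
have [Pq|nPq] := boolP (inP q).
  exists rho; first by rewrite rho0.
  by move=> p; rewrite inE => /predU1P[->|]; [rewrite Pq|exact: H].
have /QP qN := sub q (mem_head _ _).
have [rho' /andP[rho'0 rho'r] H'] := KN_taylor_part_vanish r0 sf KN PE D0
  (fun t i => ltnW (eN t i)) qN (fun h => negP nPq (asboolT h)).
exists (Num.min rho rho'); first by rewrite lt_min rho0 rho'0 ge_min rhor.
move=> p; rewrite inE => /predU1P[-> _|pQ nPp] x hx.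
  have /(taylor_part_vanish (enum_uniq 'I_n)) := H'; apply.
    exact: smooth_le sf.
  by apply: cube_le hx; rewrite ge_min lexx orbT.
by apply: (H p) => //; apply: cube_le hx; rewrite ge_min lexx.
Qed.

(** The parts with exponents off the polyhedron vanish, and those without
    remainders are the Taylor monomials. *)
Lemma newton_expansion : exists rho C : R, [/\ 0 < rho, rho <= r, 0 <= C &
  forall x, cube rho x ->
    `|f x - \sum_(q <- Q | low q) c q * monomial q x| <=
    C * \sum_(q <- Q | ~~ low q && inP q) `|monomial q x|].
Proof.
have [rho1 /andP[rho10 rho1r] H1] := @vanishing_parts Q (fun _ => id).
have [q i /QP qN _|rho2 [C [rho20 rho2r C0 H2]]] :=
  @taylor_part_bound_all R n r N (enum 'I_n) f Q r0 (enum_uniq _) _ sf; first exact: qN.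
exists (Num.min rho1 rho2), C; split=> //.
- by rewrite lt_min rho10.
- by rewrite ge_min rho1r.
move=> x hx; have x1 : cube rho1 x by apply: cube_le hx; rewrite ge_min lexx.
have x2 : cube rho2 x by apply: cube_le hx; rewrite ge_min lexx orbT.
rewrite -{1}(sum_taylor_part N f x (enum_uniq 'I_n)) -/Q [X in X - _](bigID low) /=.
rewrite [X in X + _ - _](eq_bigr (fun q => c q * monomial q x)); last first.
  by move=> q ql; apply: (taylor_part_low ql); exact: cube_le x1.
rewrite addrC addKr [X in `|X|](bigID inP) /= [X in _ + X]big1_seq ?addr0; last first.
  by move=> q /andP[/andP[_ nPq] qQ]; exact: H1.
apply: le_trans (ler_norm_sum _ _ _) _; rewrite mulr_sumr.
rewrite [leLHS]big_seq_cond [leRHS]big_seq_cond; apply: ler_sum => q /andP[qQ _].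
by rewrite norm_monomial; have := H2 q x qQ x2; rewrite big_enum.
Qed.

Section Face.
Variables (w : 'rV[R]_n) (l : R).
Hypotheses (w0 : forall i, 0 < w 0 i).
Hypotheses (lw : forall t, t \in D -> l <= dot w (int_point (e t))).

Let F := face_of P w l.

Lemma newton_valid : valid_pair P w l.
Proof. by rewrite /P PE; apply: hull_up_valid => // i; exact/ltW/w0. Qed.

(** On a face with a positive weight every point is a convex combination of
    generators, so its integer points stay below the order [N]: the face part only
    involves Taylor monomials. *)
Lemma face_low q : F (int_point q) -> low q.
Proof.
rewrite /F /P PE => -[[lam [l0 lD l1 lx]] wq].
have [_ h] := hull_up_face_coef (fun i => ltW (w0 i)) lw l0 lD l1 lx wq.
apply/forallP => i; have := h i; rewrite gt_eqF // => /(_ isT).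
rewrite mxE => E; have [t _] := set0Pn _ D0.
have N0 : (0 < N)%N by apply: leq_ltn_trans (eN t i).
rewrite -(prednK N0) ltnS -(ler_nat R) E.
have <- : \sum_t lam t * N.-1%:R = N.-1%:R :> R by rewrite -mulr_suml l1 mul1r.
apply: ler_sum => s _; rewrite mxE ler_wpM2l // ler_nat -ltnS prednK //.
Qed.

Definition face_poly x := \sum_(q <- Q | low q && (dot w (int_point q) == l)) c q * monomial q x.

Lemma face_partE x : face_part f F x = face_poly x.
Proof.
pose s := [seq q <- Q | `[< F (int_point q) >]].
rewrite /face_part (@fsbigE _ _ _ _ _ s); last 3 first.
- by rewrite filter_uniq // exponents_uniq ?enum_uniq.
- by move=> q; rewrite /= mem_filter => /andP[/asboolP].
- move=> q Fq /negP; rewrite mem_filter => -[]; rewrite asboolT //=.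
  by apply/QP => i; apply/ltnW; have /forallP := face_low Fq; apply.
rewrite /face_poly big_filter_cond [RHS](bigID (fun q => `[< F (int_point q) >])) /=.
rewrite [X in _ + X]big1 ?addr0.
  apply: eq_bigl => q; apply/andP/andP => [[/asboolP Fq _]|[_ /asboolP Fq]].
    by split; [rewrite face_low //=; case: Fq => _ /eqP|apply/asboolP].
  by split; [apply/asboolP|rewrite inE].
move=> q /andP[/andP[_ /eqP wq] /asboolP nF]; have [->|cq] := eqVneq (c q) 0.
  by rewrite mul0r.
by case: nF; split => //; exact: taylor_coeff_newton.
Qed.

Lemma smooth_face_poly s : smooth s face_poly.
Proof.
rewrite /face_poly; under eq_fun do rewrite -big_filter.
by apply: smooth_sum => q; apply: smoothZ; exact: smooth_monomial.
Qed.

Hypothesis f_ge0 : \forall x \near (0 : 'rV[R]_n), 0 <= f x.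

(** The face part is the limit of [f (t^w x) / t^l]: all other monomials and all
    remainders carry higher powers of [t]. *)
Lemma face_poly_ge0 x : 0 <= face_poly x.
Proof.
have [rho [C [rho0 rhor C0 H]]] := newton_expansion.
have [rho' rho'0 H'] := near0_cube f_ge0.
apply/ler_addgt0Pr => eps eps0; have eps2 : 0 < eps / 2 by rewrite divr_gt0.
pose s1 := [seq q <- Q | [&& low q, dot w (int_point q) != l & c q != 0]].
pose s2 := [seq q <- Q | ~~ low q && inP q].
have s1P q : q \in s1 -> 0 < dot w (int_point q) - l.
  rewrite mem_filter => /andP[/and3P[_ wq cq] _]; rewrite subr_gt0 lt_neqAle eq_sym wq.
  by apply: newton_valid; exact: taylor_coeff_newton.
have s2P q : q \in s2 -> 0 < dot w (int_point q) - l.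
  rewrite mem_filter => /andP[/andP[nl /asboolP Pq] _]; rewrite subr_gt0 lt_neqAle.
  rewrite newton_valid // andbT eq_sym; apply: contra nl => /eqP wq.
  by apply: face_low; split.
have h1 := powR_sum_small (fun q => c q * monomial q x) eps2 s1P.
have h2 := powR_sum_small (fun q => C * `|monomial q x|) eps2 s2P.
have h3 : \forall t \near (0 : R)^'+, cube (Num.min rho rho') (weighted_scale w t x).
  apply: (@filter_forall _ _ (fun i t => `|weighted_scale w t x 0 i| < Num.min rho rho')) => i.
  have m0 : 0 < Num.min rho rho' by rewrite lt_min rho0.
  have := @powR_sum_small R _ [:: i] (fun i => w 0 i) (fun i => x 0 i) _ m0.
  case=> [j|]; first by rewrite inE => /eqP->; exact: w0.
  move=> d d0 hd; exists d => // t td t0; rewrite mxE.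
  by have := hd t td t0; rewrite big_seq1.
have [t [[t0 ht1] [ht2 ht3]]] := filter_ex
  (filterI (filterI (nbhs_right_gt (0 : R)) h1) (filterI h2 h3)).
have tl : 0 < t `^ l by exact: powR_gt0.
have powE a : t `^ a = t `^ l * t `^ (a - l).
  by rewrite -powRD ?subrKC // (gt_eqF t0) implybT.
have xt1 : cube rho (weighted_scale w t x) by apply: cube_le ht3; rewrite ge_min lexx.
have xt2 : cube rho' (weighted_scale w t x) by apply: cube_le ht3; rewrite ge_min lexx orbT.
have ft0 := H' _ xt2; have := H _ xt1.
have -> : \sum_(q <- Q | low q) c q * monomial q (weighted_scale w t x) =
  t `^ l * (face_poly x + \sum_(q <- s1) t `^ (dot w (int_point q) - l) * (c q * monomial q x)).
  rewrite mulrDr (bigID (fun q => dot w (int_point q) == l)) /=; congr (_ + _).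
    rewrite mulr_sumr; apply: eq_bigr => q /andP[_ /eqP <-].
    by rewrite monomial_scale // mulrCA.
  rewrite mulr_sumr big_filter (bigID (fun q => c q != 0)) /= [X in _ + X]big1 ?addr0.
    apply: eq_big => [q|q _]; first by rewrite andbA.
    by rewrite monomial_scale // mulrCA [RHS]mulrA -powE.
  by move=> q /andP[_ /negPn/eqP->]; rewrite mul0r.
have -> : C * \sum_(q <- Q | ~~ low q && inP q) `|monomial q (weighted_scale w t x)| =
  t `^ l * \sum_(q <- s2) t `^ (dot w (int_point q) - l) * (C * `|monomial q x|).
  rewrite !mulr_sumr big_filter; apply: eq_bigr => q _.
  rewrite monomial_scale // normrM ger0_norm ?powR_ge0 // mulrA -powE; ring.
move=> h; rewrite -(pmulr_rge0 _ tl).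
have k1 := ltW (le_lt_trans (ler_norm _) ht1).
have k2 := ltW (le_lt_trans (ler_norm _) ht2).
have := le_trans (ler_norm _) h; rewrite lerBlDr => /(le_trans ft0).
rewrite -mulrDr => {}h; apply: (le_trans h); rewrite ler_pM2l //.
set A := \sum_(q <- s1) _ in k1 *; set B := \sum_(q <- s2) _ in k2 *; lra.
Qed.

Hypothesis f_nondeg : newton_nondegenerate f.
Hypothesis l_attained : exists2 t, t \in D & dot w (int_point (e t)) = l.

(** A zero of the nonnegative face part would be a minimum, hence a critical
    point. *)
Lemma face_poly_gt0 x : (forall i, x 0 i != 0) -> 0 < face_poly x.
Proof.
move=> x0; rewrite lt_def face_poly_ge0 andbT; apply/negP => /eqP px.
have Ff : is_face P F.
  exists w, l; split=> //; first exact: newton_valid.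
  have [t tD wt] := l_attained; exists (int_point (e t)); split=> //; exact: eP.
have cF : compact F.
  rewrite /F /P PE; apply: hull_up_face_compact => // t i; by rewrite mxE.
apply: (f_nondeg Ff cF); exists x; split=> // j.
have -> : face_part f F = face_poly by apply/funext => y; exact: face_partE.
rewrite (@partial_slice _ _ _ x j (fun t => face_poly (upd x j t))) //.
have dP t : derivable (fun t => face_poly (upd x j t)) t 1.
  rewrite -derivable_upd.
  have [K hK] : exists K, cube K (upd x j t).
    exists (\sum_i `|upd x j t 0 i| + 1) => i; rewrite (bigD1 i) //= -addrA ltrDl.
    by rewrite ltr_wpDl // sumr_ge0.
  exact: (smooth_derivable (smooth_face_poly _) hK).
have := @derive1_at_min R (fun t => face_poly (upd x j t)) (x 0 j - 1) (x 0 j + 1) (x 0 j).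
case=> //.
- by lra.
- by rewrite in_itv /=; apply/andP; split; lra.
- by move=> t _; rewrite upd_id px; exact: face_poly_ge0.
Qed.

End Face.

Hypothesis f_ge0 : \forall x \near (0 : 'rV[R]_n), 0 <= f x.
Hypothesis f_nondeg : newton_nondegenerate f.

Let torus x := forall i, x 0 i != 0.

Let G (eps : R) : set 'rV[R]_n := [set x | [/\ cube eps x, torus x &
  exists2 t, t \in D & f x < eps * `|monomial (e t) x|]].

(** If all the [G eps] are nonempty, an ultrafilter contains them. Along it, let
    [t0] index a dominant vertex, and call [q] bounded when [x^q] is comparable
    with the dominant monomial. Solving the linear system given by the bounded
    exponents with a fixed pseudo-inverse splits off a bounded vector [v] from the
    logarithmic coordinates [u] such that [w = u - v] is constant on the bounded
    exponents: they span a compact face with weight [w], whose face part at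
    [y = x * exp w], a point of a fixed compact subset of the torus, dominates. *)
Lemma lower_bound_torus : exists2 eps : R, 0 < eps & G eps = set0.
Proof.
apply: contrapT => noG.
have Gn0 (eps : R) : 0 < eps -> G eps !=set0.
  by move=> eps0; apply/set0P/eqP => G0; apply: noG; exists eps.
have Gle (a b : R) : a <= b -> G a `<=` G b.
  move=> ab x [xa xt [t tD fx]]; split=> //; first exact: cube_le xa.
  by exists t => //; apply: lt_le_trans fx _; apply: ler_wpM2r.
pose FG := filter_from [set eps : R | 0 < eps] G.
have FGP : ProperFilter FG.
  apply: filter_from_proper; last by move=> eps; exact: Gn0.
  apply: filter_from_filter; first by exists 1; exact: ltr01.
  move=> a b /= a0 b0; exists (Num.min a b); first by rewrite /= lt_min a0.
  by move=> x hx; split; apply: Gle hx; rewrite ge_min lexx ?orbT.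
have [U [UU FGU]] := ultraFilterLemma FGP.
have UF : Filter U by exact: (@ultra_proper _ _ UU).
have UG eps : 0 < eps -> U (G eps) by move=> eps0; apply: FGU; exists eps.
have dich A : U A \/ U (~` A) by exact: in_ultra_setVsetC.
have Uex A : U A -> A !=set0 by move=> /filter_ex.
pose u x : 'rV[R]_n := \row_i - ln `|x 0 i|.
have Ubig M : U [set x | forall i, M < u x 0 i].
  apply: filterS (UG (expR (- M)) (expR_gt0 _)) => x [xM xt _] i; rewrite mxE ltrNr.
  by rewrite -ltr_expR lnK ?posrE ?normr_gt0.
have [t0 t0D Ut0] : exists2 t0, t0 \in D & U [set x | forall t, t \in D ->
    dot (u x) (int_point (e t0)) <= dot (u x) (int_point (e t))].
  apply: contrapT => h.
  have : U [set x | forall t0, t0 \in D -> ~ (forall t, t \in D ->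
      dot (u x) (int_point (e t0)) <= dot (u x) (int_point (e t)))].
    apply: filter_forall => t0; have [t0D|_] := boolP (t0 \in D); last exact: filterE.
    have [h'|] := dich [set x | forall t, t \in D ->
      dot (u x) (int_point (e t0)) <= dot (u x) (int_point (e t))].
      by case: h; exists t0.
    by apply: filterS => x hx _.
  move/Uex => [x hx]; have [t tD ht] := exists_min_dot (fun t => int_point (e t)) (u x) D0.
  exact: hx tD ht.
pose d q : 'rV[R]_n := int_point q - int_point (e t0).
pose bnd q := `[< exists B, U [set x | dot (u x) (d q) <= B] >].
have unbnd q B : ~~ bnd q -> U [set x | B < dot (u x) (d q)].
  move=> /asboolPn nb; have [h|] := dich [set x | dot (u x) (d q) <= B].
    by case: nb; exists B.
  by apply: filterS => x /= /negP; rewrite -ltNge.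
have Uge0 : U [set x | forall q, inP q -> 0 <= dot (u x) (d q)].
  apply: filterS2 (Ubig 0) Ut0 => x /= ux hx q /asboolP Pq.
  rewrite dotBr subr_ge0; move: Pq; rewrite /P PE.
  by apply: hull_up_valid => // i; exact/ltW/ux.
pose S := [seq q <- Q | inP q].
pose Sj (k : 'I_(size S)) := tnth (in_tuple S) k.
have SjP (k : 'I_(size S)) : inP (Sj k).
  by have := mem_tnth k (in_tuple S); rewrite mem_filter => /andP[].
have Sidx q : q \in Q -> inP q -> exists k, Sj k = q.
  move=> qQ Pq; have /tnthP[k ->] : q \in in_tuple S by rewrite mem_filter Pq.
  by exists k.
pose Mx : 'M[R]_(n, size S) := \matrix_(i, k) (if bnd (Sj k) then d (Sj k) 0 i else 0).
have mulMx (y : 'rV[R]_n) k : (y *m Mx) 0 k = if bnd (Sj k) then dot y (d (Sj k)) else 0.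
  rewrite mxE; case: ifP => b; first by apply: eq_bigr => i _; rewrite !mxE b.
  by rewrite big1 // => i _; rewrite mxE b mulr0.
have [B B0 UB] : exists2 B, 0 <= B & U [set x | forall k, bnd (Sj k) -> dot (u x) (d (Sj k)) <= B].
  have /choice[b hb] k : exists b, bnd (Sj k) -> U [set x | dot (u x) (d (Sj k)) <= b].
    by have [/asboolP[b hb]|nb] := boolP (bnd (Sj k)); [exists b|exists 0].
  exists (\sum_k `|b k|); first exact: sumr_ge0.
  apply: filter_forall => k; have [bj|_] := boolP (bnd (Sj k)); last exact: filterE.
  apply: filterS (hb k bj) => x /= h _; apply: le_trans h _; apply: le_trans (ler_norm _) _.
  by rewrite (bigD1 k) //= lerDl sumr_ge0.
pose v x : 'rV[R]_n := (u x *m Mx) *m pinvmx Mx.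
pose w x := u x - v x.
have wd x k : bnd (Sj k) -> dot (w x) (d (Sj k)) = 0.
  have : w x *m Mx = 0 by rewrite mulmxBl mulmxKpV ?subrr // submxMl.
  by move/rowP/(_ k); rewrite mulMx mxE => h b; rewrite b in h.
pose B' := \sum_i \sum_k B * `|pinvmx Mx k i|.
have B'0 : 0 <= B' by do 2!apply: sumr_ge0 => ? _; exact: mulr_ge0.
have Uv : U [set x | forall i, `|v x 0 i| <= B'].
  apply: filterS2 Uge0 UB => x /= h0 hB i; rewrite mxE.
  apply: le_trans (ler_norm_sum _ _ _) _.
  rewrite /B' [leRHS](bigD1 i) //= -[leLHS]addr0; apply: lerD; last first.
    by do 2!apply: sumr_ge0 => ? _; exact: mulr_ge0.
  apply: ler_sum => k _; rewrite normrM; apply: ler_wpM2r => //; rewrite mulMx.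
  by case: ifP => b; [rewrite ger0_norm ?h0 ?hB|rewrite normr0].
pose B2 := \sum_(q <- S) \sum_i B' * `|d q 0 i|.
have dotv x q : (forall i, `|v x 0 i| <= B') -> q \in S -> dot (v x) (d q) <= B2.
  move=> vB qS; apply: le_trans (ler_norm _) _; apply: le_trans (ler_norm_sum _ _ _) _.
  apply: (@le_trans _ _ (\sum_i B' * `|d q 0 i|)).
    by apply: ler_sum => i _; rewrite normrM; exact: ler_wpM2r.
  rewrite /B2 (bigD1_seq q) ?filter_uniq ?exponents_uniq ?enum_uniq //= lerDl.
  by do 2!apply: sumr_ge0 => ? _; exact: mulr_ge0.
have [rho [C [rho0 rhor C0 fE]]] := newton_expansion.
have UA (L : R) : U [set x | [/\ cube rho x, torus x, (forall i, `|v x 0 i| <= B'),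
     (forall i, 0 < w x 0 i) & forall q, q \in Q -> inP q -> ~~ bnd q ->
        L <= dot (w x) (d q)]].
  have Unb : U [set x | forall k, ~~ bnd (Sj k) -> L + B2 < dot (u x) (d (Sj k))].
    apply: filter_forall => k; have [_|nb] := boolP (bnd (Sj k)); first exact: filterE.
    by apply: filterS (unbnd _ (L + B2) nb) => x h _.
  apply: filterS2 (filterI (UG rho rho0) (Ubig B')) (filterI Uv Unb).
  move=> x [[xrho xt _] uB] [vB hu]; split=> //.
    move=> i; rewrite /w mxE [X in _ + X]mxE subr_gt0; apply: le_lt_trans (uB i).
    exact: le_trans (ler_norm _) (vB i).
  move=> q qQ Pq nb; have [k Ej] := Sidx q qQ Pq; have := hu k; rewrite Ej => /(_ nb) h.
  have := dotv x q vB; rewrite mem_filter Pq qQ => /(_ isT).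
  rewrite /w dotBl; lra.
(* a single weight identifies the face, which is the same for all points *)
have [x1 [_ _ _ w1p w1q]] := Uex _ (UA 1).
set w1 := w x1 in w1p w1q; pose l := dot w1 (int_point (e t0)).
have w1b q : q \in Q -> inP q -> bnd q -> dot w1 (int_point q) = l.
  move=> qQ Pq; have [k <-] := Sidx q qQ Pq => /(wd x1 k) /eqP.
  by rewrite dotBr subr_eq0 => /eqP.
have w1n q : q \in Q -> inP q -> ~~ bnd q -> l < dot w1 (int_point q).
  move=> qQ Pq nb; have := w1q q qQ Pq nb; rewrite dotBr -/l; lra.
have w1l q : q \in Q -> inP q -> (dot w1 (int_point q) == l) = bnd q.
  move=> qQ Pq; have [b|nb] := boolP (bnd q); first by rewrite w1b ?eqxx.
  by rewrite gt_eqF // w1n.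
have lw t : t \in D -> l <= dot w1 (int_point (e t)).
  move=> tD; have Pt : inP (e t) by apply/asboolP; exact: eP.
  have [b|nb] := boolP (bnd (e t)); first by rewrite w1b.
  by apply/ltW/w1n.
pose g := face_poly w1 l.
have [kap kap0 gkap] : exists2 kap, 0 < kap & forall y,
    (forall i, expR (- B') <= `|y 0 i| <= expR B') -> kap <= g y.
  pose K := [set y : 'rV[R]_n | forall i, expR (- B') <= `|y 0 i| <= expR B'].
  have K1 : K !=set0.
    exists (const_mx 1) => i; rewrite mxE normr1 -expR0 !ler_expR oppr_le0.
    by rewrite B'0.
  have cK : compact K.
    pose A : set R := [set z | expR (- B') <= `|z| <= expR B'].
    apply: (@rV_compact R n (fun=> A)) => _.
    apply: (@subclosed_compact _ A `[- expR B', expR B']%classic).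
    - apply: (@closed_comp _ _ (fun z : R => `|z|) `[expR (- B'), expR B']%classic).
        by move=> z _; exact: norm_continuous.
      exact: interval_closed.
    - exact: segment_compact.
    - by move=> z /= /andP[_]; rewrite in_itv /= ler_norml.
  have [y yK ymin] := EVT_min_rV K1 cK
    (continuous_subspaceT (everywhere_continuous (@smooth_face_poly w1 l))).
  exists (g y); first last.
    by move=> z zK; apply: ymin; rewrite inE.
  apply: face_poly_gt0 => // [|i]; first by exists t0.
  have /andP[+ _] : expR (- B') <= `|y 0 i| <= expR B' by move: yK; rewrite inE; apply.
   rewrite -normr_gt0; apply: lt_le_trans; exact: expR_gt0.
(* [A] bounds the monomials on the compact set; [L] is chosen to make the total
   contribution off the face at most [kap / 2] *)
pose A := (expR B' ^+ N) ^+ n.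
have A0 : 0 < A by do 2!apply: exprn_gt0; exact: expR_gt0.
pose A2 := (\sum_(q <- Q) (`|c q| + C)) * A + 1.
have A20 : 0 < A2.
  rewrite ltr_wpDl // mulr_ge0 ?(ltW A0) // sumr_ge0 // => q _.
  by rewrite addr_ge0.
pose L := Num.max 0 (- ln (kap / (2 * A2))).
have kA2 : 0 < kap / (2 * A2) by rewrite divr_gt0 // mulr_gt0.
have eps0 : 0 < kap / (2 * A) by rewrite divr_gt0 // mulr_gt0.
have [x [[xrho xt vB wp wq] [_ _ [t tD]]]] := Uex _ (filterI (UA L) (UG _ eps0)).
apply/negP; rewrite -leNgt.
pose y : 'rV[R]_n := \row_i (x 0 i * expR (w x 0 i)).
have yv i : `|y 0 i| = expR (- v x 0 i).
  rewrite mxE normrM [X in _ * X]ger0_norm ?expR_ge0 //.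
  have -> : `|x 0 i| = expR (- u x 0 i) by rewrite mxE opprK lnK ?posrE ?normr_gt0.
  by rewrite -expRD /w !mxE; congr expR; ring.
have yB i : expR (- B') <= `|y 0 i| <= expR B'.
  by rewrite yv !ler_expR lerN2; have := vB i; rewrite ler_norml => /andP[h1 h2];
    rewrite h2 lerNl h1.
have monxy q : monomial q x = expR (- dot (w x) (int_point q)) * monomial q y.
  rewrite /dot -sumrN expR_sum -big_split; apply: eq_bigr => i _ /=.
  rewrite !mxE exprMn mulrCA -expRM_natr -expRD.
  by rewrite addNr expR0 mulr1.
have monyA q : q \in Q -> `|monomial q y| <= A.
  move=> /QP qN; rewrite norm_monomial /A -[n in X in _ <= X]card_ord -prodr_const.
  apply: ler_prod => i _; rewrite exprn_ge0 //=.
  have /andP[_ h] := yB i; apply: (@le_trans _ _ (expR B' ^+ q i)).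
    by rewrite lerXn2r // nnegrE expR_ge0.
  by rewrite ler_weXn2l // -expR0 ler_expR.
pose E := expR (dot (w x) (int_point (e t0))).
have E0 : 0 < E by exact: expR_gt0.
have monE q : E * monomial q x = expR (- dot (w x) (d q)) * monomial q y.
  by rewrite monxy mulrA -expRD dotBr opprB.
have small q : q \in Q -> inP q -> ~~ bnd q -> `|E * monomial q x| <= kap / (2 * A2) * A.
  move=> qQ Pq nb; rewrite monE normrM ger0_norm ?expR_ge0 //.
  apply: ler_pM; [exact: expR_ge0|exact: normr_ge0| |exact: monyA].
  rewrite -[leRHS]lnK ?posrE //.
  rewrite ler_expR lerNl; apply: le_trans (wq _ qQ Pq nb).
  by rewrite le_max lexx orbT.
have Et : E * `|monomial (e t) x| <= A.
  rewrite -[E]gtr0_norm // -normrM monE normrM ger0_norm ?expR_ge0 // -[leRHS]mul1r.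
  apply: ler_pM; [exact: expR_ge0|exact: normr_ge0| |exact: monyA].
  rewrite -expR0 ler_expR oppr_le0.
  have Pt : inP (e t) by apply/asboolP; exact: eP.
  have [b|nb] := boolP (bnd (e t)).
    by have [k Ej] := Sidx _ (eQ t) Pt; rewrite -Ej wd ?Ej.
  by apply: le_trans (wq _ (eQ t) Pt nb); rewrite le_max lexx.
have cP q : c q != 0 -> inP q by move=> /taylor_coeff_newton h; apply/asboolP.
have nlow q : ~~ low q -> q \in Q -> inP q -> ~~ bnd q.
  move=> nl qQ Pq; apply: contra nl => b; apply: (face_low w1p lw).
  by split; [exact/asboolP|exact: w1b].
pose eta := kap / (2 * A2) * A.
have eta0 : 0 <= eta by apply/ltW/mulr_gt0.
have lowE : E * \sum_(q <- Q | low q) c q * monomial q x >= g y - \sum_(q <- Q) `|c q| * eta.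
  rewrite [X in _ <= _ * X](bigID (fun q => dot w1 (int_point q) == l)) /= mulrDr; apply: lerD.
    rewrite /g /face_poly mulr_sumr big_seq_cond [leRHS]big_seq_cond le_eqVlt; apply/orP; left.
    apply/eqP; apply: eq_bigr => q /andP[qQ /andP[_ wl]].
    have [->|cq] := eqVneq (c q) 0; first by rewrite !mul0r mulr0.
    rewrite mulrCA monE; congr (_ * _).
    have Pq := cP q cq; move: wl; rewrite w1l // => b.
    have [k Ej] := Sidx q qQ Pq.
    have -> : dot (w x) (d q) = 0 by rewrite -Ej wd ?Ej.
    by rewrite oppr0 expR0 mul1r.
  rewrite lerNl; apply: le_trans (ler_norm _) _; rewrite normrN mulr_sumr.
  apply: le_trans (ler_norm_sum _ _ _) _.
  rewrite big_seq_cond [leRHS]big_seq_cond [leRHS](bigID (fun q => low q && (dot w1 (int_point q) != l))) /=.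
  rewrite -[leLHS]addr0; apply: lerD; last first.
    by apply: sumr_ge0 => q _; rewrite mulr_ge0.
  rewrite [leRHS](eq_bigl (fun q => (q \in Q) && (low q && (dot w1 (int_point q) != l)))) => [|q]; last by rewrite andbT.
  apply: ler_sum => q /andP[qQ /andP[_ wl]]; rewrite mulrCA normrM.
  have [->|cq] := eqVneq (c q) 0; first by rewrite normr0 !mul0r.
  apply: ler_wpM2l => //; apply: small => //; first exact: cP.
  by rewrite -w1l // cP.
have highE : E * (C * \sum_(q <- Q | ~~ low q && inP q) `|monomial q x|) <= \sum_(q <- Q) C * eta.
  rewrite !mulr_sumr big_seq_cond [leRHS]big_seq_cond [leRHS](bigID (fun q => ~~ low q && inP q)) /=.
  rewrite -[leLHS]addr0; apply: lerD; last first.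
    by apply: sumr_ge0 => q _; rewrite mulr_ge0.
  rewrite [leRHS](eq_bigl (fun q => (q \in Q) && (~~ low q && inP q))) => [|q]; last by rewrite andbT.
  apply: ler_sum => q /andP[qQ /andP[nl Pq]]; rewrite mulrCA; apply: ler_wpM2l => //.
  by rewrite -[E]gtr0_norm // -normrM; apply: small => //; exact: nlow.
have loss : \sum_(q <- Q) `|c q| * eta + \sum_(q <- Q) C * eta <= kap / 2.
  rewrite -!mulr_suml -mulrDl -big_split /= /eta mulrCA.
  have -> : kap / 2 = kap / (2 * A2) * A2 by field; rewrite gt_eqF.
  by apply: ler_wpM2l; [exact: ltW|rewrite /A2 lerDl].
have gy := gkap y yB.
have := fE x xrho; rewrite ler_norml => /andP[+ _]; rewrite lerBrDr => fx.
rewrite -(ler_pM2l E0); apply: (@le_trans _ _ (kap / 2)).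
  rewrite mulrCA; apply: (@le_trans _ _ (kap / (2 * A) * A)).
    by apply: ler_wpM2l => //; exact: ltW.
  by have -> : kap / (2 * A) * A = kap / 2 by field; rewrite gt_eqF.
have := ler_wpM2l (ltW E0) fx; rewrite mulrDr mulrN => {}fx.
apply: le_trans fx; lra.
Qed.

(** Points with nonzero coordinates are dense, and both sides are continuous. *)
Lemma newton_lower_bound : exists2 eps : R, 0 < eps &
  \forall x \near (0 : 'rV[R]_n), forall t, t \in D -> eps * `|monomial (e t) x| <= f x.
Proof.
have [eps eps0 Geps] := lower_bound_torus; exists eps => //.
pose rho := Num.min eps r; have rho0 : 0 < rho by rewrite lt_min eps0.
near=> x => t tD; have xrho : cube rho x by near: x; exact: cube_near0.
have xr : cube r x by apply: cube_le xrho; rewrite ge_min lexx orbT.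
rewrite -subr_ge0 leNgt; apply/negP => hx.
pose h y := f y - eps * `|monomial (e t) y|.
have ch : {for x, continuous h}.
  apply: (@continuousB R R^o); first exact: smooth_continuous xr.
  apply: continuousM; first exact: cst_continuous.
  apply: continuous_comp; last exact: norm_continuous.
  exact: (everywhere_continuous (fun s => @smooth_monomial R n s (e t))).
have : \forall y \near x, h y < 0 /\ cube rho y.
  by apply: filterI; [exact: (cvgr_lt _ ch)|exact: cube_nbhs].
case/nbhs_ballP => del /= del0 hdel.
have nz : \forall s \near (0 : R)^'+, forall i, x 0 i + s != 0.
  apply: filter_forall => i; have [xi|xi] := leP 0 (x 0 i).
    by near=> s; rewrite gt_eqF // ltr_wpDl //; near: s; exact: nbhs_right_gt.
  near=> s; rewrite lt_eqF // -ltrBrDl sub0r; near: s; apply: nbhs_right_lt.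
  by rewrite oppr_gt0.
have [s [[s0 sd] sz]] := filter_ex
  (filterI (filterI (nbhs_right_gt (0 : R)) (nbhs_right_lt del0)) nz).
pose y : 'rV[R]_n := \row_i (x 0 i + s).
have [hy yrho] : h y < 0 /\ cube rho y.
  apply: hdel; split=> // k i; rewrite (ord1 k) mxE -ball_normE /=.
  by rewrite opprD addrA subrr sub0r normrN gtr0_norm.
suff : G eps y by rewrite Geps.
split; first by apply: cube_le yrho; rewrite ge_min lexx.
  by move=> i; rewrite mxE.
by exists t => //; rewrite -subr_lt0.
Unshelve. all: by end_near. Qed.

End Newton.

(** * The two polyhedra and the distance *)

Section Extremum.
Context {R : realType}.
Implicit Types (A : set R) (m : R).

Lemma minimum_eq A m : A m -> lbound A m -> minimum A = m.
Proof.
move=> Am lm; have [Ag lg] : (A `&` lbound A) (minimum A) by apply: getPex; exists m.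
by apply/eqP; rewrite eq_le lg // lm.
Qed.

Lemma maximum_eq A m : A m -> ubound A m -> maximum A = m.
Proof.
move=> Am um; have [Ag ug] : (A `&` ubound A) (maximum A) by apply: getPex; exists m.
by apply/eqP; rewrite eq_le um // ug.
Qed.

End Extremum.

Section Distance.
Context {R : realType} {n : nat}.
Implicit Types (x y w p : 'rV[R]_n) (i j : 'I_n) (q : {ffun 'I_n -> nat}).
Implicit Types (f g : 'rV[R]_n -> R).

Lemma int_point_inj : injective (@int_point R n).
Proof.
move=> q q' /rowP E; apply/ffunP => i; have := E i; rewrite !mxE => /eqP.
by rewrite eqr_nat => /eqP.
Qed.

(** Dickson's lemma bounds the minimal exponents of the Taylor series, which
    leaves finitely many generators; the irredundant ones are the vertices. *)
Lemma newton_hull f : newton_polyhedron f !=set0 ->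
  exists (N : nat) (T : finType) (e : T -> {ffun 'I_n -> nat}) (D : {set T}),
  [/\ D != finset.set0, newton_polyhedron f = hull_up (fun t => int_point (e t)) D,
      forall t i, (e t i < N)%N,
      forall v, vertices (newton_polyhedron f) v <-> exists2 t, t \in D & v = int_point (e t) &
      forall t, t \in D -> taylor_coeff f (e t) != 0].
Proof.
move=> P0; have [M HM] := dickson [set q | taylor_coeff f q != 0].
pose T : finType := {ffun 'I_n -> 'I_M.+1}.
pose e (t : T) : {ffun 'I_n -> nat} := [ffun i => t i : nat].
pose D : {set T} := [set t | taylor_coeff f (e t) != 0]%SET.
have PE : newton_polyhedron f = hull_up (fun t => int_point (e t)) D.
  apply: convex_hull_orthants => [t|q /= /HM[b cb [bq bM]]].
    by rewrite inE => ct; exists (e t).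
  exists [ffun i => inord (b i)].
    rewrite inE (_ : e _ = b) //; apply/ffunP => i.
    by rewrite !ffunE inordK // ltnS.
  by move=> i; rewrite !mxE !ffunE inordK ?ltnS // ler_nat.
have D0 : D != finset.set0.
  have [x] := P0; rewrite PE => -[lam [_ l0 l1 _]]; apply/negP => /eqP D0.
  move: l1; rewrite big1 => [/eqP|t _]; first by rewrite eq_sym oner_eq0.
  by apply: l0; rewrite D0 inE.
have [E [ED E0 EE vE]] :=
  @hull_up_vertices R n T (fun t => int_point (e t)) D D0.
exists M.+1, T, e, E; split=> //.
- by rewrite PE EE.
- by move=> t i; rewrite ffunE.
- by move=> v; rewrite PE.
- by move=> t /(fintype.subsetP ED); rewrite inE.
Qed.

Definition hat_exp q : {ffun 'I_n -> nat} := [ffun i => (q i != 0%N) : nat].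

Lemma hat_int_point q : hat q = int_point (hat_exp q) :> 'rV[R]_n.
Proof. by apply/rowP => i; rewrite !mxE ffunE. Qed.

Lemma hat_hull f (T : finType) (e : T -> {ffun 'I_n -> nat}) (D : {set T}) :
  (forall v, vertices (newton_polyhedron f) v <-> exists2 t, t \in D & v = int_point (e t)) ->
  hat_polyhedron f = hull_up (fun t => hat (e t)) D.
Proof.
move=> vP; apply: convex_hull_orthants => [t tD|q /= /vP[t tD /int_point_inj->]].
  by exists (e t) => //=; apply/vP; exists t.
by exists t.
Qed.

(** The distance is attained: the points of a ray that are separated from the
    polyhedron form an open set. *)
Lemma ray_distanceP (T : finType) (a : T -> 'rV[R]_n) (D : {set T}) v :
  ~ hull_up a D 0 -> (exists2 s : R, 0 < s & hull_up a D (s *: v)) ->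
  (forall i, 0 <= v 0 i) ->
  exists2 d, 0 < d & hull_up a D (d *: v) /\
    forall s : R, 0 < s -> hull_up a D (s *: v) -> d <= s.
Proof.
move=> n0 [s0 s00 hs0] v0; pose A := [set s : R | 0 < s /\ hull_up a D (s *: v)].
have A0 : A !=set0 by exists s0.
have Alb : lbound A 0 by move=> s [/ltW].
have Ainf : has_inf A by split=> //; exists 0.
have d0 : 0 <= inf A by exact: lb_le_inf.
have Ad : hull_up a D (inf A *: v).
  apply: contrapT => /hull_up_sep[w [wp hw]].
  have wv : 0 <= dot w v by apply: dot_ge0 => // i; exact/ltW.
  have D0 : D != finset.set0.
    case: hs0 => lam [_ l0 l1 _]; apply/negP => /eqP D0.
    move: l1; rewrite big1 => [/eqP|t _]; first by rewrite eq_sym oner_eq0.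
    by apply: l0; rewrite D0 inE.
  have [t tD tmin] := exists_min_dot a w D0.
  have gap : 0 < (dot w (a t) - dot w (inf A *: v)) / (dot w v + 1).
    by rewrite divr_gt0 ?subr_gt0 ?hw // ltr_wpDl.
  have [s [_ Ps] sd] := inf_adherent gap Ainf.
  have := hull_up_valid (fun i => ltW (wp i)) tmin Ps; rewrite leNgt => /negP; apply.
  rewrite dotZr; apply: (@le_lt_trans _ _ ((inf A + (dot w (a t) - dot w (inf A *: v)) / (dot w v + 1)) * dot w v)).
    by apply: ler_wpM2r => //; exact: ltW.
  rewrite mulrDl -dotZr -ltrBrDl mulrAC ltr_pdivrMr ?ltr_wpDl //.
  by rewrite mulrDr mulr1 ltrDl subr_gt0 hw.
have dp : 0 < inf A.
  by rewrite lt_def d0 andbT; apply/negP => /eqP E; apply: n0; rewrite E scale0r in Ad.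
exists (inf A) => //; split=> // s s_gt0 Ps; apply: ge_inf => //.
by exists 0.
Qed.

Lemma powRD_ge0 (b u v : R) : 0 <= u -> 0 <= v -> b `^ (u + v) = b `^ u * b `^ v.
Proof.
move=> u0 v0; have [->|bn0] := eqVneq b 0; last by rewrite powRD // bn0 implybT.
have [->|un0] := eqVneq u 0; first by rewrite add0r powRr0 mul1r.
by rewrite (powR0 un0) mul0r powR0 // gt_eqF // ltr_wpDr // lt_def un0 u0.
Qed.

Lemma powR_sum (I : Type) (s : seq I) (b : R) (F : I -> R) : (forall k, 0 <= F k) ->
  b `^ (\sum_(i <- s) F i) = \prod_(i <- s) b `^ F i.
Proof.
move=> F0; elim: s => [|i s IH]; first by rewrite !big_nil powRr0.
by rewrite !big_cons powRD_ge0 ?IH // sumr_ge0.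
Qed.

Lemma powR_prod (I : Type) (s : seq I) (F : I -> R) (b : R) : (forall k, 0 <= F k) ->
  (\prod_(i <- s) F i) `^ b = \prod_(i <- s) F i `^ b.
Proof.
move=> F0; elim: s => [|i s IH]; first by rewrite !big_nil powR1.
by rewrite !big_cons powRM ?IH // prodr_ge0.
Qed.

(** Weighted arithmetic-geometric mean: powers are multiplicatively convex in
    the exponent, and decreasing because the bases are at most 1. *)
Lemma prod_powR_hull (T : finType) (a : T -> 'rV[R]_n) (D : {set T}) (z p : 'rV[R]_n) (K : R) :
  (forall i, 0 <= z 0 i <= 1) -> (forall t i, 0 <= a t 0 i) -> 0 <= K ->
  (forall t, t \in D -> \prod_i z 0 i `^ a t 0 i <= K) ->
  hull_up a D p -> \prod_i z 0 i `^ p 0 i <= K.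
Proof.
move=> z01 a0 K0 hK [lam [l0 lD l1 lp]].
have z0 i : 0 <= z 0 i by case/andP: (z01 i).
apply: (@le_trans _ _ (\prod_i z 0 i `^ (\sum_t lam t * a t 0 i))).
  apply: ler_prod => i _; rewrite powR_ge0 /=.
  have /andP[_ zi1] := z01 i; have [zi|zi] := eqVneq (z 0 i) 0; last first.
    by apply: ger_powR => //; rewrite zi1 lt_def zi z0.
  rewrite zi; have [E|E] := eqVneq (p 0 i) 0; last by rewrite powR0 // powR_ge0.
  have -> : \sum_t lam t * a t 0 i = 0.
    have := lp i; rewrite E => lpi; apply/eqP; rewrite eq_le lpi /=; apply: sumr_ge0 => t _; exact: mulr_ge0.
  by rewrite E.
under eq_bigr => i _ do rewrite (powR_sum _ _ (fun t => mulr_ge0 (l0 t) (a0 t i))).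
rewrite exchange_big /=.
have -> : K = \prod_t K `^ lam t by rewrite -powR_sum // l1 powRr1.
apply: ler_prod => t _; apply/andP; split; first by apply: prodr_ge0 => i _; exact: powR_ge0.
have [tD|tD] := boolP (t \in D); last first.
  by rewrite lD // powRr0; under eq_bigr do rewrite mul0r powRr0; rewrite big1.
have -> : \prod_i z 0 i `^ (lam t * a t 0 i) = (\prod_i z 0 i `^ a t 0 i) `^ lam t.
  rewrite powR_prod => [|i]; last exact: powR_ge0.
  by apply: eq_bigr => i _; rewrite mulrC powRrM.
apply: ge0_ler_powR => //; rewrite ?nnegrE ?hK //.
by apply: prodr_ge0 => i _; exact: powR_ge0.
Qed.

Lemma enorm_coord x i : `|x 0 i| <= enorm x.
Proof.
rewrite -sqrtr_sqr /enorm ler_wsqrtr // (bigD1 i) //= lerDl.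
by apply: sumr_ge0 => j _; exact: sqr_ge0.
Qed.

Lemma enorm_cube x (eps : R) : 0 < eps -> cube (eps / n.+1%:R) x -> enorm x < eps.
Proof.
move=> eps0 hx; have E : eps = Num.sqrt (eps ^+ 2) by rewrite sqrtr_sqr gtr0_norm.
rewrite E /enorm ltr_sqrt ?exprn_gt0 //.
have m0 : 0 < n.+1%:R :> R by rewrite ltr0n.
apply: (@le_lt_trans _ _ (\sum_(i < n) (eps / n.+1%:R) ^+ 2)).
  apply: ler_sum => i _; rewrite -(real_normK (num_real (x 0 i))).
  by rewrite lerXn2r ?nnegrE ?divr_ge0 ?(ltW eps0) // ltW.
rewrite sumr_const card_ord -[_ *+ n]mulr_natr expr_div_n mulrAC.
rewrite ltr_pdivrMr ?exprn_gt0 // ltr_pM2l ?exprn_gt0 //.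
by rewrite -natrX ltr_nat expnS expn1 mulnS mulSn addSn ltnS; nia.
Qed.

End Distance.

(** * The exponent *)

Section Exponent.
Context {R : realType} {n : nat}.
Implicit Types (x y w p : 'rV[R]_n) (i j : 'I_n) (q : {ffun 'I_n -> nat}).
Implicit Types (g : 'rV[R]_n -> R).

Variables (f : 'rV[R]_n -> R) (r : R) (T : finType) (e : T -> {ffun 'I_n -> nat}).
Variables (D : {set T}) (N : nat).
Hypotheses (r0 : 0 < r) (sf : smooth r f) (KN : KN_condition f).
Hypothesis PE : newton_polyhedron f = hull_up (fun t => int_point (e t)) D.
Hypotheses (D0 : D != finset.set0) (eN : forall t i, (e t i < N)%N).

Lemma monomial_eq0 q y i : q i != 0%N -> y 0 i = 0 -> monomial q y = 0.
Proof. by move=> qi yi; rewrite /monomial (bigD1 i) //= yi expr0n (negPf qi) mul0r. Qed.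

(** Every exponent of the polyhedron lies above a convex combination of vertices,
    so that each monomial of the expansion has a vanishing variable. *)
Lemma newton_zero : exists2 rho : R, 0 < rho & forall y, cube rho y ->
  (forall t, t \in D -> exists2 i, e t i != 0%N & y 0 i = 0) -> f y = 0.
Proof.
have [rho [C [rho0 _ C0 H]]] := newton_expansion r0 sf KN PE D0 eN.
exists rho => // y yrho hy.
have mon0 q : newton_polyhedron f (int_point q) -> monomial q y = 0.
  rewrite PE => -[lam [l0 lD l1 lq]].
  have [t lt] : exists t, lam t != 0.
    apply: contrapT => /forallNP h0; move: l1; rewrite big1 => [/eqP|s _].
      by rewrite eq_sym oner_eq0.
    by apply/eqP; apply: contrapT => /negP; exact: h0.
  have tD : t \in D by apply: contraNT lt => /lD->.
  have [i ei yi] := hy t tD; apply: (monomial_eq0 _ yi).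
  apply: contraTneq (lq i) => qi; rewrite -ltNge mxE qi (bigD1 t) //= ltr_pwDl //.
    by rewrite mulr_gt0 ?mxE ?ltr0n ?lt0n // lt_def lt l0.
  by apply: sumr_ge0 => s _; rewrite mulr_ge0 // mxE.
have := H y yrho; rewrite [X in f y - X]big1 => [|q _]; last first.
  have [->|cq] := eqVneq (taylor_coeff f q) 0; first by rewrite mul0r.
  by rewrite mon0 ?mulr0 //; exact: taylor_coeff_newton.
rewrite [X in C * X]big1 => [|q /andP[_ /asboolP Pq]]; last by rewrite mon0 // normr0.
by rewrite subr0 mulr0 normr_le0 => /eqP.
Qed.

(** Hadamard's lemma: a smooth [g] vanishing on the zero set of [f], a union of
    coordinate subspaces, is bounded by the squarefree monomials. In the
    first-order expansion of [g], the part with remainders in the variables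
    [i] with [q i = 1] is either divisible by such a monomial, or it is built
    from the restriction of [g] to a subspace on which [f] vanishes. *)
Lemma vanishing_bound g : smooth_near0 g ->
  (\forall x \near (0 : 'rV[R]_n), f x = 0 -> g x = 0) ->
  exists rho C : R, [/\ 0 < rho, 0 <= C & forall x, cube rho x ->
    `|g x| <= C * \sum_(t in D) `|monomial (hat_exp (e t)) x|].
Proof.
move=> [V [oV V0 sV]] fg.
have [r1 r10 r1V] : exists2 r1, 0 < r1 & cube r1 `<=` V.
  by apply: near0_cube; exact: open_nbhs_nbhs.
have sg : smooth r1 g by exact: smooth_on_smooth sV.
have [r2 r20 r2f] := newton_zero.
have [r3 r30 r3g] := near0_cube fg.
pose M x := \sum_(t in D) `|monomial (hat_exp (e t)) x|.
have M0 x : 0 <= M x by apply: sumr_ge0.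
pose r' := Num.min (Num.min r1 1) (Num.min r2 r3).
have r'0 : 0 < r' by rewrite !lt_min r10 r20 r30 ltr01.
have r'P x : cube r' x -> [/\ cube r1 x, cube 1 x, cube r2 x & cube r3 x].
  by move=> h; split; apply: cube_le h; rewrite !ge_min lexx ?orbT.
suff [rho [C [rho0 C0 H]]] : exists rho C : R, [/\ 0 < rho, 0 <= C & forall x, cube rho x ->
    \sum_(q <- exponents 1 (enum 'I_n)) `|taylor_part 1 (enum 'I_n) q g x| <= C * M x].
  exists rho, C; split=> // x xrho.
  rewrite -[g x](sum_taylor_part 1 g x (enum_uniq 'I_n)).
  exact: le_trans (ler_norm_sum _ _ _) (H x xrho).
have : {subset exponents 1 (enum 'I_n) <= exponents 1 (enum 'I_n)} by [].
elim: {1 3}(exponents 1 (enum 'I_n)) => [_|q Q IH sub].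
  by exists 1, 0; split=> // x _; rewrite big_nil mul0r.
have [p pQ|rho [C [rho0 C0 H]]] := IH; first by apply: sub; rewrite inE pQ orbT.
have [q1 _] := exponentsP _ _ (enum_uniq 'I_n) (sub q (mem_head _ _)).
suff [rho' [C' [rho'0 C'0 H']]] : exists rho' C' : R, [/\ 0 < rho', 0 <= C' & forall x,
    cube rho' x -> `|taylor_part 1 (enum 'I_n) q g x| <= C' * M x].
  exists (Num.min rho rho'), (C' + C); split.
  - by rewrite lt_min rho0.
  - exact: addr_ge0.
  move=> x hx; rewrite big_cons mulrDl; apply: lerD.
    by apply: H'; apply: cube_le hx; rewrite ge_min lexx orbT.
  by apply: H; apply: cube_le hx; rewrite ge_min lexx.
have [[t tD tq]|no] := pselect (exists2 t, t \in D & forall i, e t i != 0%N -> q i != 0%N).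
  have [rho' [C' [rho'0 _ C'0 H']]] := taylor_part_bound r10 (enum_uniq 'I_n) q1 sg.
  exists (Num.min rho' 1), C'; split=> //; first by rewrite lt_min rho'0 ltr01.
  move=> x hx; have x1 : cube 1 x by apply: cube_le hx; rewrite ge_min lexx orbT.
  apply: le_trans (H' x _) _; first by apply: cube_le hx; rewrite ge_min lexx.
  apply: ler_wpM2l => //; rewrite /M (bigD1 t) //= -[leLHS]addr0.
  apply: lerD; last exact: sumr_ge0.
  rewrite norm_monomial big_enum; apply: ler_prod => i _.
  rewrite exprn_ge0 //= ffunE; have := tq i; case: eqP => _ /= qi.
    by rewrite expr0; apply: exprn_ile1 => //; exact/ltW/x1.
  have -> : q i = 1%N by apply/eqP; rewrite eqn_leq q1 ?mem_enum // lt0n qi.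
  by [].
exists r', 0; split=> // x hx; rewrite mul0r normr_le0; apply/eqP.
have r'r1 : r' <= r1 by rewrite !ge_min lexx.
apply: (taylor_part_vanish (enum_uniq 'I_n) (smooth_le r'r1 sg)) hx => y hy.
have [y1 y1' y2 y3] := r'P y hy.
set s := [seq i <- _ | _].
have us : uniq s by rewrite filter_uniq ?enum_uniq.
have qs i : i \in s -> (q i < 1)%N by rewrite mem_filter => /andP[].
rewrite (taylor_part_explicit us qs sg y1).
have -> : flatten [seq nseq (q i) i | i <- s] = [::].
  by elim: (s) qs => //= i s' IHs qs; rewrite IHs => [|k ks]; have := qs i (mem_head _ _);
    [case: (q i)|move=> _; apply: qs; rewrite inE ks orbT].
rewrite /= (r3g (zero_on s y)) ?mulr0 //; first exact: cube_zero_on.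
apply: r2f; first exact: cube_zero_on.
move=> t tD; apply: contrapT => h; apply: no; exists t => // i eti.
apply/negP => /eqP qi; apply: h; exists i => //.
by rewrite mxE mem_filter qi mem_enum.
Qed.

Hypothesis f_ge0 : \forall x \near (0 : 'rV[R]_n), 0 <= f x.
Hypothesis f_nondeg : newton_nondegenerate f.

(** The mean inequality bounds the [d]-th powers of the squarefree monomials by the
    vertex monomials, hence by [f]. *)
Lemma lojasiewicz_upper (d : R) : 0 < d ->
  (forall t, t \in D -> newton_polyhedron f (d *: hat (e t))) -> lojasiewicz_property f d.
Proof.
move=> d0 dP g sg fg.
have [eps eps0 /near0_cube[r1 r10 r1f]] :=
  newton_lower_bound r0 sf KN PE D0 eN f_ge0 f_nondeg.
have [r2 [C [r20 C0 r2g]]] := vanishing_bound sg fg.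
pose A := (C * #|D|%:R) `^ d; have A0 : 0 <= A by exact: powR_ge0.
have A1 : 0 < A + 1 by rewrite ltr_wpDl.
exists (eps / (A + 1)), (Num.min (Num.min r1 r2) 1); split.
- by rewrite divr_gt0.
- by rewrite !lt_min r10 r20 ltr01.
move=> x; rewrite !lt_min => /andP[/andP[x1 x2] x3].
have xcube s : enorm x < s -> cube s x by move=> xs i; apply: le_lt_trans xs; exact: enorm_coord.
have lower t : t \in D -> `|monomial (e t) x| <= f x / eps.
  by move=> tD; rewrite ler_pdivlMr // mulrC; apply: (r1f x (xcube _ x1)).
have [t0 t0D] := set0Pn _ D0.
have K0 : 0 <= f x / eps by apply: le_trans (lower t0 t0D).
have fx0 : 0 <= f x by move: K0; rewrite pmulr_lge0 ?invr_gt0.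
pose z : 'rV[R]_n := \row_i `|x 0 i|.
have monz q : `|monomial q x| = \prod_i z 0 i `^ int_point q 0 i.
  by rewrite norm_monomial; apply: eq_bigr => i _; rewrite !mxE powR_mulrn.
have hatK t : t \in D -> `|monomial (hat_exp (e t)) x| <= (f x / eps) `^ d^-1.
  move=> tD; have -> : `|monomial (hat_exp (e t)) x| = (`|monomial (hat_exp (e t)) x| `^ d) `^ d^-1.
    by rewrite -powRrM mulfV ?gt_eqF // powRr1.
  apply: ge0_ler_powR; rewrite ?nnegrE ?invr_ge0 ?powR_ge0 ?(ltW d0) //.
  have -> : `|monomial (hat_exp (e t)) x| `^ d = \prod_i z 0 i `^ (d *: hat (e t)) 0 i.
    rewrite monz powR_prod => [|i]; last exact: powR_ge0.
    by apply: eq_bigr => i _; rewrite -powRrM hat_int_point mxE [in RHS]mxE mulrC.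
  have := dP t tD; rewrite PE; apply: prod_powR_hull => //.
  + by move=> i; rewrite mxE normr_ge0 /=; apply/ltW/(xcube _ x3).
  + by move=> s i; rewrite mxE.
  + by move=> s sD; rewrite -monz; exact: lower.
have gx : `|g x| <= C * #|D|%:R * (f x / eps) `^ d^-1.
  apply: le_trans (r2g x (xcube _ x2)) _; rewrite -mulrA; apply: ler_wpM2l => //.
  apply: (@le_trans _ _ (\sum_(t in D) (f x / eps) `^ d^-1)); first exact: ler_sum.
  by rewrite sumr_const mulr_natl.
have gd : `|g x| `^ d <= A * (f x / eps).
  apply: (@le_trans _ _ ((C * #|D|%:R * (f x / eps) `^ d^-1) `^ d)).
    apply: ge0_ler_powR => //; rewrite ?nnegrE ?(ltW d0) //.
    by rewrite !mulr_ge0 ?powR_ge0.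
  rewrite powRM ?mulr_ge0 ?powR_ge0 // -powRrM mulVf ?gt_eqF // powRr1 //.
rewrite (ger0_norm fx0); apply: (@le_trans _ _ (eps / (A + 1) * (A * (f x / eps)))).
  by apply: ler_wpM2l => //; rewrite divr_ge0 // ltW.
have -> : eps / (A + 1) * (A * (f x / eps)) = A / (A + 1) * f x.
  by field; rewrite !gt_eqF.
rewrite -[leRHS]mul1r; apply: ler_wpM2r => //.
by rewrite ler_pdivrMr // mul1r lerDl.
Qed.

(** The squarefree monomial of a vertex vanishes on the zero set of [f]. Were
    [alpha] times its exponent off the Newton polyhedron, a separating weight
    would give a curve along which [f] decreases faster than allowed. *)
Lemma lojasiewicz_lower (alpha : R) t : lojasiewicz_property f alpha -> t \in D ->
  newton_polyhedron f (alpha *: hat (e t)).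
Proof.
move=> Lf tD; set h := hat_exp (e t); rewrite hat_int_point -/h.
have [||c [eps [c0 eps0 Lg]]] := Lf (monomial h).
- exists (cube 1); split; last by apply: smooth_smooth_on; exact: smooth_monomial.
    by rewrite openE => x; exact: cube_nbhs.
  by move=> i; rewrite mxE normr0.
- have [k k0 fk] := newton_lower_bound r0 sf KN PE D0 eN f_ge0 f_nondeg.
  apply: filterS fk => x fk fx.
  have : monomial (e t) x == 0.
    rewrite -normr_le0 -(pmulr_rle0 _ k0) -fx; exact: fk.
  rewrite prodf_seq_eq0 => /hasP[i _ /=]; rewrite expf_eq0 => /andP[ei /eqP xi].
  by apply: (@monomial_eq0 _ _ i) => //; rewrite ffunE -lt0n lt0b -lt0n.
rewrite PE; apply: contrapT => /hull_up_sep[w [wp hw]].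
have [tm tmD tmin] := exists_min_dot (fun t => int_point (e t)) w D0.
set l := dot w (int_point (e tm)) in tmin.
have face : defines_face (newton_polyhedron f) w l (face_of (newton_polyhedron f) w l).
  rewrite PE; split=> //; first by apply: hull_up_valid => // i; exact/ltW.
  by exists (int_point (e tm)); split => //; exact: (hull_up_gen (fun t => int_point (e t))).
have [rho rho0 KN1] := near0_cube (KN face).
have eps'0 : 0 < eps / n.+1%:R by rewrite divr_gt0.
pose s := Num.min rho (eps / n.+1%:R) / 2.
have m0 : 0 < Num.min rho (eps / n.+1%:R) by rewrite lt_min rho0.
have s0 : 0 < s by rewrite divr_gt0.
pose x : 'rV[R]_n := const_mx s.
have xs : cube (Num.min rho (eps / n.+1%:R)) x.
  by move=> i; rewrite mxE gtr0_norm // /s ltr_pdivrMr // ltr_pMr // ltr1n.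
have xrho : cube rho x by apply: cube_le xs; rewrite ge_min lexx.
have [K hK] := cvg_powR_bounded (KN1 x xrho).
pose B := c * `|monomial h x| `^ alpha.
have B0 : 0 < B.
  rewrite mulr_gt0 // powR_gt0 // normr_gt0 prodf_seq_neq0; apply/allP => i _ /=.
  by rewrite expf_neq0 // mxE gt_eqF.
have gap : 0 < l - dot w (alpha *: int_point h) by rewrite subr_gt0; exact: hw.
have := @powR_sum_small R _ [:: tt] (fun=> l - dot w (alpha *: int_point h)) (fun=> K) _ B0.
move=> /(_ (fun _ _ => gap)) hs.
have [a [[a0 a1] [aK aB]]] := filter_ex (filterI
  (filterI (nbhs_right_gt (0 : R)) (nbhs_right_le (@ltr01 R))) (filterI hK hs)).
have ax : enorm (weighted_scale w a x) < eps.
  apply: enorm_cube => //; apply: cube_scale => [i||]; [exact/ltW|by rewrite a0|].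
  by apply: cube_le xs; rewrite ge_min lexx orbT.
have al : 0 < a `^ l by exact: powR_gt0.
have := le_trans (Lg _ ax) aK.
rewrite monomial_scale // normrM ger0_norm ?powR_ge0 // powRM ?powR_ge0 //.
rewrite mulrCA -/B -powRrM mulrC [dot _ _ * _]mulrC -dotZr => le1.
move: aB; rewrite big_seq1 => /(le_lt_trans (ler_norm _)).
rewrite powRB; last by rewrite (gt_eqF a0) implybT.
rewrite mulrAC ltr_pdivrMr ?powR_gt0 // mulrC ltNge.
by rewrite le1.
Qed.

End Exponent.

Unset Implicit Arguments.

Theorem theorem4p3p2 (R : realType) (n : nat) (U : set 'rV[R]_n)
    (f : 'rV[R]_n -> R)
    (U_open : open U) (U0 : U 0) (f_smooth : smooth_on U f)
    (f0 : f 0 = 0) (grad0 : forall i : 'I_n, partial i f 0 = 0)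
    (newton_neq0 : newton_polyhedron f !=set0)
    (f_ge0 : forall x, U x -> 0 <= f x)
    (f_nondeg : newton_nondegenerate f) (f_KN : KN_condition f) :
  lojasiewicz_exponent f = (newton_distance f)%:E.
Proof.
have U_nbhs : \forall x \near (0 : 'rV[R]_n), U x by exact: open_nbhs_nbhs.
have [r r0 rU] := near0_cube U_nbhs.
have sf : smooth r f by exact: smooth_on_smooth f_smooth.
have f_ge0' : \forall x \near (0 : 'rV[R]_n), 0 <= f x by apply: filterS U_nbhs.
have [N [T [e [D [D0 PE eN vP cD]]]]] := newton_hull newton_neq0.
have hatE := hat_hull vP.
have [H [HD H0 HE vH]] := @hull_up_vertices R n T (fun t => hat (e t)) D D0.
(* a generator [0] would have the coefficient [f 0] *)
have n0 : ~ hull_up (fun t => int_point (e t) : 'rV[R]_n) D 0.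
  move=> [lam [l0 lD l1 lx]].
  have [t lt] : exists t, lam t != 0.
    apply: contrapT => /forallNP h0; move: l1; rewrite big1 => [/eqP|s _].
      by rewrite eq_sym oner_eq0.
    by apply/eqP; apply: contrapT => /negP; exact: h0.
  have tD : t \in D by apply: contraNT lt => /lD->.
  have et0 : e t = [ffun=> 0%N].
    apply/ffunP => i; rewrite ffunE; apply/eqP; apply: contraTT (lx i) => eti.
    rewrite -ltNge mxE (bigD1 t) //= ltr_pwDl //.
      by rewrite mulr_gt0 ?mxE ?ltr0n ?lt0n // lt_def lt l0.
    by apply: sumr_ge0 => s _; rewrite mulr_ge0 // mxE.
  have /eqP := cD t tD; apply; rewrite et0 /taylor_coeff /deriv_multi.
  rewrite (_ : flatten _ = [::]) /= ?f0 ?mul0r //.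
  by elim: (enum 'I_n) => //= i s ->; rewrite ffunE.
have ray t : t \in D -> exists d, [/\ 0 < d, newton_polyhedron f (d *: hat (e t)) &
    forall s : R, 0 < s -> newton_polyhedron f (s *: hat (e t)) -> d <= s].
  move=> tD; have [||d d0 [Pd dmin]] := ray_distanceP (v := hat (e t)) n0.
  - exists N.+1%:R => //; apply: hull_up_le (hull_up_gen _ tD) _ => i.
    rewrite !mxE; case: (eqVneq (e t i) 0%N) => [->|_]; first by rewrite mulr0.
    by rewrite mulr1 ler_nat; apply: leqW; exact/ltnW/eN.
  - by move=> i; rewrite mxE.
  - by exists d; rewrite PE.
have /choice[d hd] t : exists d, t \in D -> [/\ 0 < d, newton_polyhedron f (d *: hat (e t)) &
    forall s : R, 0 < s -> newton_polyhedron f (s *: hat (e t)) -> d <= s].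
  by have [/ray[d hd]|_] := boolP (t \in D); [exists d|exists 0].
have subD t : t \in H -> t \in D by exact: (fintype.subsetP HD).
have rayE t : t \in H -> ray_distance f (hat (e t)) = d t.
  move=> /subD tD; have [d0 Pd dmin] := hd t tD.
  by apply: minimum_eq => [//|s [s0 Ps]]; exact: dmin.
have [s0 s0H] := set0Pn _ H0.
have [tm] := @exists_min_seq R _ (enum H) (fun t => - d t) s0 ltac:(by rewrite mem_enum).
rewrite mem_enum => tmH dmax.
have dE : newton_distance f = d tm.
  apply: maximum_eq => [|_ [v + <-]].
    exists (hat (e tm)); last exact: rayE.
    by rewrite hatE; apply/vH; exists tm.
  rewrite hatE => /vH[t tH ->]; rewrite rayE //.
  by rewrite -lerN2 dmax // mem_enum.
have [dm0 Pdm dmmin] := hd tm (subD _ tmH).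
rewrite dE; apply/eqP; rewrite eq_le; apply/andP; split.
  (* scaled by the largest distance, all the 0/1 vectors enter the polyhedron,
     which is convex and closed upwards *)
  apply: ereal_inf_lbound; exists (d tm) => //; split=> //.
  apply: (lojasiewicz_upper r0 sf f_KN PE D0 eN f_ge0' f_nondeg dm0) => t tD.
  have [lam [l0 lD l1 lt]] : hull_up (fun t => hat (e t) : 'rV[R]_n) H (hat (e t)).
    by rewrite HE; exact: (hull_up_gen (fun t => hat (e t) : 'rV[R]_n)).
  have dP s : s \in H -> newton_polyhedron f (d tm *: hat (e s)).
    move=> sH; have [ds0 Pds _] := hd s (subD _ sH); move: Pds; rewrite PE => Pds.
    apply: hull_up_le Pds _ => i; rewrite !mxE; apply: ler_wpM2r => //.
    by rewrite -lerN2 dmax // mem_enum.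
  have cP : convex_set (newton_polyhedron f : set (convex_lmodType 'rV[R]_n)).
    by rewrite PE; exact: hull_up_convex.
  have := convex_set_sum cP dP l0 lD l1; rewrite PE => h; apply: hull_up_le h _ => i.
  rewrite summxE mxE (le_trans _ (ler_wpM2l (ltW dm0) (lt i))) // mulr_sumr.
  by apply: ler_sum => s _; rewrite !mxE mulrCA.
apply: le_ereal_inf_tmp => _ [alpha [alpha0 La] <-]; rewrite lee_fin.
apply: dmmin => //.
exact: (lojasiewicz_lower r0 sf f_KN PE D0 eN f_ge0' f_nondeg La (subD _ tmH)).
Qed.
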